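(* Let $S = \{s_1, \ldots, s_n\}$ be a set of segments in $\mathbb{R}^3$, affinely spanning $\mathbb{R}^3$. If $S$ is antipodal, then $n \leq 4$; if $S$ is strictly antipodal, then $n \leq 3$. For the antipodal case we have equality ($n=4$) if and only if the segments are subsegments of some four parallel edges of a parallelepiped (one of each), or they are subsegments of two parallel edges of a face of a parallelepiped, and of two parallel edges of the opposite face of the parallelepiped, which are not parallel to the first two edges (one of each). For the strictly antipodal case we have equality ($n=3$) if and only if the segments are subsegments of the three lateral edges of a triangular prism (one of each), or they are subsegments of the relative interiors of three mutually skew edges of a parallelepiped (one of each).
   Context: Segments are non-degenerate, closed, bounded line segments ($1$-simplices). For a finite set $S=\{s_1,\dots,s_n\}$ of segments in $\mathbb{R}^3$ with $\operatorname{aff}(\bigcup_{i=1}^n s_i)=\mathbb{R}^3$ (this is the meaning of ''affinely spanning $\mathbb{R}^3$''), let $P:=\operatorname{conv}(\bigcup_{i=1}^n s_i)$. $S$ is antipodal if for any $i\neq j$ there are different parallel supporting planes $H',H''$ of $P$ with $s_i\subset H'$ and $s_j\subset H''$. $S$ is strictly antipodal if for any $i\ne j$ there are different parallel supporting planes $H',H''$ of $P$ with $s_i=P\cap H'$ and $s_j=P\cap H''$. *)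

(* Defs.v *)
From HB Require Import structures.
From mathcomp Require Import all_boot all_order all_algebra.
From mathcomp Require Import all_classical all_reals all_analysis.
Import Order.TTheory GRing.Theory Num.Theory.
Import numFieldNormedType.Exports.

Set Implicit Arguments.
Unset Strict Implicit.
Unset Printing Implicit Defensive.

Local Open Scope classical_set_scope.
Local Open Scope ring_scope.

Section Geometry.
Variable R : realType.
Local Notation E := 'rV[R]_3.
Implicit Types (A P Q H F G e : set E).

Definition affine_set A :=
  forall (x y : E) (t : R), A x -> A y -> A ((1 - t) *: x + t *: y).

Definition aff_hull A : set E := smallest affine_set A.

Definition conv_hull A : set E := smallest (@convex_set R E) A.

Definition is_segment e :=
  exists a b : E, a != b /\ e = conv_hull [set a; b].

Definition relint A : set E :=
  [set x | A x /\ within (aff_hull A) (nbhs x) A].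

(* Intended for sets whose affine hulls have the same dimension (two segments,
   two planes, two facets); a set is parallel to itself. *)
Definition parallel A B :=
  exists v : E, aff_hull B = [set x + v | x in aff_hull A].

Definition skew e e' :=
  ~ parallel e e' /\ aff_hull e `&` aff_hull e' = set0.

Definition plane (u : E) (c : R) : set E := [set x | (x *m u^T) 0 0 = c].

(* Replacing (u, c) by (- u, - c) shows that [P] may lie on either side. *)
Definition supporting_plane P H :=
  exists (u : E) (c : R),
    [/\ u != 0, H = plane u c,
        forall x, P x -> (x *m u^T) 0 0 <= c & P `&` H !=set0].

Definition parallel_supporting_planes P H H' :=
  [/\ supporting_plane P H, supporting_plane P H', parallel H H' & H <> H'].

Definition is_edge Q e :=
  (exists2 H, supporting_plane Q H & e = Q `&` H) /\ is_segment e.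

Definition is_facet Q F :=
  exists2 H, supporting_plane Q H & F = Q `&` H /\ aff_hull F = H.

(* The rows of [V] are the three edge vectors at the vertex [p]. *)
Definition is_parallelepiped Q :=
  exists (p : E) (V : 'M[R]_3),
    row_free V /\
    Q = [set p + c *m V | c in [set c : E | forall j, 0 <= c 0 j <= 1]].

Section Family.
Variables (n : nat) (s : 'I_n -> set E).

Definition hull_of_union : set E := conv_hull (\bigcup_i s i).

Definition antipodal :=
  forall i j, i != j -> exists H H',
    parallel_supporting_planes hull_of_union H H' /\
    (s i `<=` H /\ s j `<=` H').

Definition strictly_antipodal :=
  forall i j, i != j -> exists H H',
    parallel_supporting_planes hull_of_union H H' /\
    (s i = hull_of_union `&` H /\ s j = hull_of_union `&` H').

Definition one_in_each (m : nat) (e : 'I_m -> set E) :=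
  exists f : 'I_n -> 'I_m, bijective f /\ forall i, s i `<=` e (f i).

Definition on_four_parallel_edges :=
  exists Q (e : 'I_4 -> set E),
    [/\ is_parallelepiped Q,
        injective e,
        forall k, is_edge Q (e k),
        forall k l, parallel (e k) (e l)
      & one_in_each e].

(* In a parallelepiped the facet opposite to [F] is the only other facet that
   is parallel to [F], and the edges of a facet are the edges contained in it. *)
Definition on_parallel_edges_of_opposite_faces :=
  exists Q F G (e1 e2 e3 e4 : set E),
    [/\ is_parallelepiped Q,
        [/\ is_facet Q F, is_facet Q G, parallel F G & F <> G],
        [/\ is_edge Q e1, is_edge Q e2, e1 `<=` F, e2 `<=` F & e1 <> e2],
        [/\ is_edge Q e3, is_edge Q e4, e3 `<=` G, e4 `<=` G & e3 <> e4]
      & [/\ parallel e1 e2, parallel e3 e4, ~ parallel e1 e3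
          & one_in_each (tnth [tuple e1; e2; e3; e4])]].

(* The prism is the convex hull of the triangle with vertices [t k] and its
   translate by [u]; it spans the space exactly when the triangle is
   non-degenerate and [u] is not parallel to its plane. *)
Definition on_lateral_edges_of_triangular_prism :=
  exists (t : 'I_3 -> E) (u : E),
    aff_hull (conv_hull (range t `|` range (fun k => t k + u))) = setT /\
    one_in_each (fun k => conv_hull [set t k; t k + u]).

Definition inside_three_skew_edges :=
  exists Q (e : 'I_3 -> set E),
    [/\ is_parallelepiped Q,
        forall k, is_edge Q (e k),
        forall k l, k != l -> skew (e k) (e l)
      & one_in_each (fun k => relint (e k))].

End Family.
End Geometry.

(* Main.v *)
Require Import Defs.
From mathcomp Require Import all_boot all_order all_algebra.
From mathcomp Require Import all_classical all_reals all_analysis.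
From mathcomp Require Import ring lra.
Import Order.TTheory GRing.Theory Num.Theory.
Import numFieldNormedType.Exports.
Set Implicit Arguments.
Unset Strict Implicit.
Unset Printing Implicit Defensive.
Local Open Scope classical_set_scope.
Local Open Scope ring_scope.

(* The set is antipodal iff for all i <> j some affine function F_ij is 1 on
   s_i, 0 on s_j and in [0, 1] on every segment. The linear part of F_ij kills
   the directions of s_i and s_j, hence F_ij is unique when these directions are
   not parallel. Three pairwise non-parallel directions are therefore linearly
   independent, and F_23, F_31, F_12 are affine coordinates in which the segments
   lie on three mutually skew edges of the unit cube; a sign analysis of F_14,
   F_24, F_34 shows that there is no fourth segment. If there are two directions,
   F_ij is constant on each parallel class, so that a class lies in a plane and
   has at most two members. If all directions are parallel, project along them:
   the barycentric coordinates of a fourth point with respect to three others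
   must be 1, 1, -1, a parallelogram, and there is no room for a fifth point.
   In the strict case 0 < F_ij < 1 on the remaining segments, which rules out all
   configurations of four segments, and two parallel segments with a third one
   that is not parallel to them. *)

(** * Inequalities between coordinates *)

(** For non-parallel directions the normal of F_ij is unique up to a factor, so functions of
    different pairs whose normals kill the same two directions are proportional up to a constant.
    Comparing their values on the segments involved is the device behind all statements about
    directions. F_14, F_24 and F_34 are less rigid, since the fourth direction is unknown: each
    carries an unknown scale, which is eliminated by the condition that it vanishes on the fourth
    segment. The sign of the resulting denominator is not known, which is what makes a case analysis
    unavoidable. That analysis uses strict bounds on the coordinates of a point of the fourth
    segment. They hold at its midpoint when no coordinate of its direction vanishes; directions with
    a vanishing coordinate are treated apart. *)

Section Scalars.
Variable R : realFieldType.
Implicit Types a b c t u v x y z : R.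

(** This is 0 <= v / u <= 1 with u nonzero, written without division so that each sign of u leaves
    polynomial inequalities. *)
Definition between0 v u := (0 < u /\ 0 <= v <= u) \/ (u < 0 /\ u <= v <= 0).

Lemma between0_scale u v lam :
  lam * u = 1 -> 0 <= lam * v <= 1 -> between0 v u.
Proof.
move=> lu /andP[l0 l1].
have [u0|u0|u0] := ltgtP u 0; last by move: lu; rewrite u0 mulr0; lra.
- right; split=> //; apply/andP; split; nra.
- left; split=> //; apply/andP; split; nra.
Qed.

Lemma between0N u v : between0 v u -> between0 (- v) (- u).
Proof. by case=> [[u0 /andP[? ?]]|[u0 /andP[? ?]]]; [right|left]; split; try lra;
  apply/andP; split; lra. Qed.

(* In the coordinates of [fourth_slab] below, the first three segments contain
   (t1, 0, 1), (1, t2, 0), (0, 1, t3), and the fourth one has direction (a, b, c)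
   and contains (x, y, z). Up to a factor, c Y + b (1 - Z) is 1 - F_14, and the
   other two functions come from it by rotating the coordinates. *)
Definition crossing a b c x y z t1 t2 t3 :=
  [/\ between0 (c * t2 + b) (c * y + b * (1 - z)) /\
      between0 (c + b * (1 - t3)) (c * y + b * (1 - z)),
      between0 (a * t3 + c) (a * z + c * (1 - x)) /\
      between0 (a + c * (1 - t1)) (a * z + c * (1 - x))
    & between0 (b * t1 + a) (b * x + a * (1 - y)) /\
      between0 (b + a * (1 - t2)) (b * x + a * (1 - y))].

Lemma crossing_rot a b c x y z t1 t2 t3 :
  crossing a b c x y z t1 t2 t3 -> crossing b c a y z x t2 t3 t1.
Proof. by case=> ? ? ?; split. Qed.

Lemma crossingN a b c x y z t1 t2 t3 :
  crossing a b c x y z t1 t2 t3 -> crossing (- a) (- b) (- c) x y z t1 t2 t3.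
Proof.
have E (p q r s : R) : - p * r + - q * s = - (p * r + q * s) by ring.
have E1 (p q r : R) : - p * r + - q = - (p * r + q) by ring.
have E2 (p q s : R) : - p + - q * s = - (p + q * s) by ring.
by case=> [[? ?] [? ?] [? ?]]; rewrite /crossing !E !E1 !E2; split; split;
  exact: between0N.
Qed.

(** The bound coming from F_24 gives x < t1, the one from F_34 gives t1 < x. *)
Lemma crossing_ppp a b c x y z t1 t2 t3 :
  0 < a -> 0 < b -> 0 < c -> 0 < y -> z < 1 -> 0 <= t1 <= 1 ->
  ~ crossing a b c x y z t1 t2 t3.
Proof.
move=> a0 b0 c0 y0 z1 /andP[t0 t1'] [_ [_ G2] [G3 _]].
have ay : 0 < a * y by rewrite mulr_gt0.
have az : 0 < a * (1 - z) by rewrite mulr_gt0 ?subr_gt0.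
have bt : 0 <= b * t1 by rewrite mulr_ge0 // ltW.
have ct : 0 <= c * (1 - t1) by rewrite mulr_ge0 ?subr_ge0 // ltW.
have xt : b * t1 < b * x by case: G3 => [[? /andP[? ?]]|[? /andP[? ?]]]; lra.
have tx : c * x < c * t1 by case: G2 => [[? /andP[? ?]]|[? /andP[? ?]]]; lra.
by move: xt tx; rewrite !ltr_pM2l //; lra.
Qed.

(** The bounds from F_34 do not involve c and give t1 < x and y < t2. The four cases that follow are
    the signs of the denominators of F_14 and F_24. *)
Lemma crossing_ppn a b c x y z t1 t2 t3 :
  0 < a -> 0 < b -> c < 0 ->
  0 < x < 1 -> 0 < y < 1 -> 0 < z < 1 ->
  0 <= t1 <= 1 -> 0 <= t2 <= 1 -> 0 <= t3 <= 1 ->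
  ~ crossing a b c x y z t1 t2 t3.
Proof.
move=> a0 b0 c0 /andP[x0 x1] /andP[y0 y1] /andP[z0 z1] /andP[p0 p1] /andP[q0 q1] /andP[r0 r1].
move=> [[G1 G1'] [G2 G2'] [G3 G3']].
have {G3}[A1 A2] : b * (x - t1) >= a * y /\ 0 < x - t1.
  by case: G3 => [[? /andP[? ?]]|[? /andP[? ?]]]; split; nra.
have {G3'}[B1 B2] : a * (t2 - y) >= b * (1 - x) /\ 0 < t2 - y.
  by case: G3' => [[? /andP[? ?]]|[? /andP[? ?]]]; split; nra.
pose g := - c; have g0 : 0 < g by rewrite /g; lra.
have {}c0 : c = - g by rewrite /g opprK.
rewrite {}c0 in G1 G1' G2 G2'; move: {c} g g0 G1 G1' G2 G2' => g g0.
move=> [[h1 /andP[h2 h3]]|[h1 /andP[h2 h3]]].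
  move=> [[_ /andP[i2 i3]]|[? _]]; last lra.
  move=> [[k1 /andP[k2 k3]]|[k1 /andP[k2 k3]]].
    move=> [[_ /andP[j2 j3]]|[? _]]; last lra.
    (* H1 and H2 give [a b < g (a + b)], H3 and H4 the converse inequality. *)
    have H1 : b * z < g by nra.
    have H2 : a * (1 - z) < g by nra.
    have H3 : g <= a * t3 by nra.
    have H4 : g <= b * (1 - t3) by nra.
    have : g * (a + b) <= a * b by nra.
    have : a * b < g * (a + b) by nra.
    lra.
  move=> [[? _]|[_ /andP[j2 j3]]]; first lra.
  have H1 : b * z <= g * (t2 - y) by lra.
  have H2 : g * x <= a * (t3 - z) by lra.
  have H3 : g <= b * (1 - t3) by nra.
  have H4 : a <= g * (1 - t1) by lra.
  have H5 : a < b by nra.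
  have H6 : b * (1 - x) < a by nra.
  have : b * (g * x) <= b * (a * (t3 - z)) by nra.
  have : a * g <= a * (b * (1 - t3)) by nra.
  have : b * (1 - x) * g < a * g by nra.
  nra.
move=> [[? _]|[_ /andP[i2 i3]]]; first lra.
move=> [[k1 /andP[k2 k3]]|[k1 /andP[k2 k3]]]; last first.
  (* The bounds from F_24 give z < t3, those from F_14 give t3 < z. *)
  nra.
move=> [[_ /andP[j2 j3]]|[? _]]; last lra.
(* H2, H3 and H5 will give a g < a b z, hence g < b, against H4. *)
have H1 : b <= g * t2 by lra.
have H2 : g <= a * t3 by lra.
have H3 : g * (1 - y) <= b * (z - t3) by lra.
have H4 : b <= g by nra.
have H5 : a * y < b by nra.
have : a * (g * (1 - y)) <= a * (b * (z - t3)) by nra.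
have : b * g <= b * (a * t3) by nra.
have : a * y * g < b * g by nra.
nra.
Qed.

(** Negation and rotation reduce all sign patterns of (a, b, c) to (+, +, +) and (+, +, -). *)
Lemma crossing_nondeg a b c x y z t1 t2 t3 :
  a != 0 -> b != 0 -> c != 0 ->
  0 < x < 1 -> 0 < y < 1 -> 0 < z < 1 ->
  0 <= t1 <= 1 -> 0 <= t2 <= 1 -> 0 <= t3 <= 1 ->
  ~ crossing a b c x y z t1 t2 t3.
Proof.
wlog c0 : a b c / 0 < c => [W a0 b0 c0|a0 b0 _].
  move: (c0); rewrite neq_lt => /orP[cn|cp]; last exact: W.
  move=> *; move/crossingN; apply: W; rewrite ?oppr_eq0 ?oppr_gt0 //.
move=> hx hy hz h1 h2 h3 H.
have Hr := crossing_rot H; have Hrr := crossing_rot Hr.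
have y0 : 0 < y by case/andP: hy.
have z1 : z < 1 by case/andP: hz.
move: (a0) (b0); rewrite !neq_lt => /orP[an|ap] /orP[bn|bp].
- by have /crossingN := H; apply: crossing_ppn => //; rewrite ?oppr_gt0 ?oppr_lt0.
- by apply: crossing_ppn Hr.
- by apply: crossing_ppn Hrr.
- by apply: crossing_ppp H.
Qed.


(* In the coordinates X = F_23, Y = F_31, Z = F_12 the three lines are
   (Y, Z) = (0, 1), (Z, X) = (0, 1) and (X, Y) = (0, 1); this is the function
   F_14 = 1 + be * Y + ga * (Z - 1), where (b, c) and (y, z) are the
   (Y, Z)-coordinates of the direction and of a point of the fourth segment. *)
Definition fourth_slab b c y z t2 t3 := exists be ga : R,
  [/\ be * b + ga * c = 0, 0 <= 1 + be * t2 - ga <= 1,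
      0 <= 1 + be + ga * (t3 - 1) <= 1 & 1 + be * y + ga * (z - 1) = 0].

(** The condition on the direction makes (be, ga) a multiple lam of (- c, b); vanishing on the
    fourth segment then says lam (c y + b (1 - z)) = 1. *)
Lemma fourth_slab_between0 b c y z t2 t3 :
  b != 0 -> fourth_slab b c y z t2 t3 ->
  between0 (c * t2 + b) (c * y + b * (1 - z)) /\
  between0 (c + b * (1 - t3)) (c * y + b * (1 - z)).
Proof.
move=> b0 [be [ga [E h2 h3 E1]]].
pose lam := ga / b.
have Eg : ga = lam * b by rewrite /lam divfK.
have Eb : be = - lam * c.
  by apply: (mulIf b0); have -> : - lam * c * b = - (ga * c) by [rewrite Eg; ring]; lra.
have N : lam * (c * y + b * (1 - z)) = 1.
  by move: E1; rewrite Eg Eb; lra.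
split; apply: (between0_scale N); [move: h2|move: h3]; rewrite Eg Eb;
  move=> /andP[? ?]; apply/andP; split; lra.
Qed.

Lemma fourth_slab_mid b c y z t2 t3 :
  fourth_slab b c y z t2 t3 -> fourth_slab b c (y + b / 2) (z + c / 2) t2 t3.
Proof.
by move=> [be [ga [E h2 h3 E1]]]; exists be, ga; split=> //; lra.
Qed.

(** A zero coordinate of the direction removes unknowns from the slabs. The bounds then pin
    coordinates of the point to 0 or 1, until one of the three functions equals 1 there instead of
    0. *)
Lemma fourth_slab_deg a b x y z t1 t2 t3 : (a != 0) || (b != 0) ->
  0 <= x <= 1 -> 0 <= y <= 1 -> 0 <= z <= 1 ->
  fourth_slab b 0 y z t2 t3 -> fourth_slab 0 a z x t3 t1 ->
  fourth_slab a b x y t1 t2 -> False.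
Proof.
move=> ab /andP[x0 x1] /andP[y0 y1] /andP[z0 z1].
move=> [be1 [ga1 [E1 /andP[p1 q1] /andP[r1 s1] u1]]].
move=> [be2 [ga2 [E2 /andP[p2 q2] /andP[r2 s2] u2]]].
move=> [be3 [ga3 [E3 /andP[p3 q3] /andP[r3 s3] u3]]].
have [b0|b0] := eqVneq b 0; last first.
  have {}E1 : be1 = 0 by apply: (mulIf b0); lra.
  have z_0 : z = 0 by rewrite E1 in p1 u1; nra.
  have [a0|a0] := eqVneq a 0; last first.
    have {}E2 : ga2 = 0 by apply: (mulIf a0); lra.
    by rewrite E2 z_0 in u2; lra.
  have {}E3 : ga3 = 0 by apply: (mulIf b0); rewrite a0 in E3; lra.
  have x_1 : x = 1 by rewrite E3 in r3 u3; nra.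
  by rewrite z_0 x_1 in u2; lra.
have a0 : a != 0 by move: ab; rewrite b0 eqxx orbF.
have {}E2 : ga2 = 0 by apply: (mulIf a0); lra.
have z_1 : z = 1 by rewrite E2 in r2 u2; nra.
have {}E3 : be3 = 0 by apply: (mulIf a0); rewrite b0 in E3; lra.
have y_0 : y = 0 by rewrite E3 in p3 u3; nra.
by rewrite z_1 y_0 in u1; lra.
Qed.

Lemma no_fourth_slab a b c x y z t1 t2 t3 :
  [|| a != 0, b != 0 | c != 0] ->
  0 <= x <= 1 -> 0 <= y <= 1 -> 0 <= z <= 1 ->
  0 <= x + a <= 1 -> 0 <= y + b <= 1 -> 0 <= z + c <= 1 ->
  0 <= t1 <= 1 -> 0 <= t2 <= 1 -> 0 <= t3 <= 1 ->
  fourth_slab b c y z t2 t3 -> fourth_slab c a z x t3 t1 ->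
  fourth_slab a b x y t1 t2 -> False.
Proof.
move=> abc x01 y01 z01 x01' y01' z01' h1 h2 h3 S1 S2 S3.
have [c0|c0] := eqVneq c 0.
  by subst c; apply: (fourth_slab_deg _ x01 y01 z01 S1 S2 S3); rewrite eqxx orbF in abc.
have [a0|a0] := eqVneq a 0.
  by subst a; apply: (fourth_slab_deg _ y01 z01 x01 S2 S3 S1); rewrite eqxx /= in abc.
have [b0|b0] := eqVneq b 0.
  by subst b; apply: (fourth_slab_deg _ z01 x01 y01 S3 S1 S2); rewrite c0.
have I u v : v != 0 -> 0 <= u <= 1 -> 0 <= u + v <= 1 -> 0 < u + v / 2 < 1.
  rewrite neq_lt => /orP[?|?] /andP[? ?] /andP[? ?]; apply/andP; split; lra.
apply: (@crossing_nondeg a b c (x + a / 2) (y + b / 2) (z + c / 2) t1 t2 t3);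
  rewrite ?I //.
have T1 := fourth_slab_between0 b0 (fourth_slab_mid S1).
have T2 := fourth_slab_between0 c0 (fourth_slab_mid S2).
have T3 := fourth_slab_between0 a0 (fourth_slab_mid S3).
by split; split; tauto.
Qed.

(* Four antipodal points of the plane, [al], [be], [ga] being the barycentric
   coordinates of the fourth with respect to the other three. *)
Lemma antipodal_barycentric al be ga :
  al + be + ga = 1 ->
  (exists2 t : R, 0 <= t <= 1 & 0 <= al + ga * t <= 1) ->
  (exists2 t : R, 0 <= t <= 1 & 0 <= al + be * t <= 1) ->
  (exists2 t : R, 0 <= t <= 1 & 0 <= be + al * t <= 1) ->
  (exists p q : R, [/\ 0 <= p <= 1, 0 <= q <= 1 & al + be * p + ga * q = 0]) ->
  (exists p q : R, [/\ 0 <= p <= 1, 0 <= q <= 1 & be + al * p + ga * q = 0]) ->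
  (exists p q : R, [/\ 0 <= p <= 1, 0 <= q <= 1 & ga + al * p + be * q = 0]) ->
  [\/ [/\ al = 1, be = 1 & ga = -1], [/\ al = 1, be = -1 & ga = 1]
    | [/\ al = -1, be = 1 & ga = 1]].
Proof.
move=> S [t1 /andP[a0 a1] /andP[a2 a3]] [t2 /andP[b0 b1] /andP[b2 b3]].
move=> [t3 /andP[c0 c1] /andP[c2 c3]].
move=> [p1 [q1 [/andP[d0 d1] /andP[d2 d3] d4]]].
move=> [p2 [q2 [/andP[e0 e1] /andP[e2 e3] e4]]].
move=> [p3 [q3 [/andP[f0 f1] /andP[f2 f3] f4]]].
(* If one coordinate is positive, the equation where it has coefficient 1 has left side at least the
   sum 1. If all are positive, no equation can hold. If only [al], say, is nonpositive, the slab
   bounds give be, ga <= 1 and the equations give be, ga <= - al, which with the sum 1 leaves a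
   single solution. *)
have [A|A] := lerP al 0; have [B|B] := lerP be 0; have [C|C] := lerP ga 0.
- lra.
- have : ga + al * p3 + be * q3 >= ga + al + be by nra.
  lra.
- have : be + al * p2 + ga * q2 >= ga + al + be by nra.
  lra.
- have g1 : ga <= 1 by nra.
  have bb1 : be <= 1 by nra.
  have : - al <= be by nra.
  have : - al <= ga by nra.
  have : 1 <= ga by nra.
  have : 1 <= be by nra.
  by constructor 3; split; lra.
- have : al + be * p1 + ga * q1 >= ga + al + be by nra.
  lra.
- have g1 : ga <= 1 by nra.
  have bb1 : al <= 1 by nra.
  have : 1 <= ga by nra.
  have : 1 <= al by nra.
  by constructor 2; split; lra.
- have g1 : al <= 1 by nra.
  have bb1 : be <= 1 by nra.
  have : 1 <= be by nra.
  have : 1 <= al by nra.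
  by constructor 1; split; lra.
- nra.
Qed.

End Scalars.

(** * Linear algebra in dimension three *)

Section LinearAlgebra.
Variable R : realFieldType.
Local Notation E := 'rV[R]_3.
Implicit Types (u v w x y d : E) (V : 'M[R]_3).

Definition dot x w : R := (x *m w^T) 0 0.

Lemma dotE x w : dot x w = \sum_i x 0 i * w 0 i.
Proof. by rewrite /dot mxE; apply: eq_bigr => i _; rewrite mxE. Qed.

Lemma dotC x w : dot x w = dot w x.
Proof. by rewrite !dotE; apply: eq_bigr => i _; rewrite mulrC. Qed.

Lemma dotDl x y w : dot (x + y) w = dot x w + dot y w.
Proof. by rewrite /dot mulmxDl mxE. Qed.

Lemma dotZl t x w : dot (t *: x) w = t * dot x w.
Proof. by rewrite /dot -scalemxAl mxE. Qed.

Lemma dotNl x w : dot (- x) w = - dot x w.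
Proof. by rewrite -scaleN1r dotZl mulN1r. Qed.

Lemma dotBl x y w : dot (x - y) w = dot x w - dot y w.
Proof. by rewrite dotDl dotNl. Qed.

Lemma dot0l w : dot 0 w = 0.
Proof. by rewrite /dot mul0mx mxE. Qed.

Lemma dotDr x v w : dot x (v + w) = dot x v + dot x w.
Proof. by rewrite dotC dotDl !(dotC x). Qed.

Lemma dotZr t x w : dot x (t *: w) = t * dot x w.
Proof. by rewrite dotC dotZl (dotC x). Qed.

Lemma dotNr x w : dot x (- w) = - dot x w.
Proof. by rewrite dotC dotNl (dotC x). Qed.

Lemma dotBr x v w : dot x (v - w) = dot x v - dot x w.
Proof. by rewrite dotDr dotNr. Qed.

Definition rows3 u v w : 'M[R]_3 := \matrix_i nth 0 [:: u; v; w] i.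

Lemma ord3P (P : 'I_3 -> Prop) : P 0 -> P 1 -> P 2 -> forall i, P i.
Proof.
move=> P0 P1 P2 [[|[|[|//]]] lt_i3].
- by have -> : Ordinal lt_i3 = 0 by apply: val_inj.
- by have -> : Ordinal lt_i3 = 1 by apply: val_inj.
- by have -> : Ordinal lt_i3 = 2 by apply: val_inj.
Qed.

Lemma ord3_others (k : 'I_3) : exists l m,
  [/\ l != k, m != k, l != m & forall j, [|| j == k, j == l | j == m]].
Proof.
move: k; apply: ord3P; [exists 1, 2|exists 0, 2|exists 0, 1]; split=> //;
  exact: ord3P.
Qed.

Lemma sum_ord3 (V : nmodType) (f : 'I_3 -> V) : \sum_i f i = f 0 + f 1 + f 2.
Proof.
rewrite !big_ord_recr big_ord0 /= add0r.
by congr (f _ + f _ + f _); apply: val_inj.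
Qed.

Lemma row_rows3 u v w :
  (row 0 (rows3 u v w) = u) * (row 1 (rows3 u v w) = v) * (row 2 (rows3 u v w) = w).
Proof. by split; first split; apply/rowP => j; rewrite !mxE. Qed.

Lemma mul_rows3 (c : E) u v w :
  c *m rows3 u v w = c 0 0 *: u + c 0 1 *: v + c 0 2 *: w.
Proof. by apply/rowP => j; rewrite !mxE sum_ord3 !mxE. Qed.

Lemma orthogonal_dependent V w :
  w != 0 -> (forall i, dot (row i V) w = 0) -> ~~ row_free V.
Proof.
move=> w0 Vw; apply/negP => /row_freeP[B VB].
have : V *m w^T = 0.
  by apply/colP => i; rewrite [RHS]mxE -(Vw i) /dot -row_mul [RHS]mxE.
move=> Vw0; case/eqP: w0; apply: trmx_inj; rewrite trmx0.
have /mulmx1C BV := VB.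
by rewrite -[LHS]mul1mx -BV -mulmxA Vw0 mulmx0.
Qed.

Lemma dependent_row V : ~~ row_free V -> exists2 c : E, c != 0 & c *m V = 0.
Proof.
rewrite -kermx_eq0 => /rowV0Pn[c /sub_kermxP cV c0]; by exists c.
Qed.
Lemma rows3_free u v w :
  (forall al be ga, al *: u + be *: v + ga *: w = 0 ->
    [/\ al = 0, be = 0 & ga = 0]) -> row_free (rows3 u v w).
Proof.
move=> H; apply: contraT => /dependent_row[c c0]; rewrite mul_rows3 => /H[c_0 c_1 c_2].
by case/eqP: c0; apply/rowP => i; rewrite mxE; move: i; apply: ord3P.
Qed.

Lemma rows3_comb u v w : row_free (rows3 u v w) -> forall x,
  exists al be ga, x = al *: u + be *: v + ga *: w.
Proof.
rewrite row_free_unit => U x; pose c := x *m invmx (rows3 u v w).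
by exists (c 0 0), (c 0 1), (c 0 2); rewrite -mul_rows3 mulmxKV.
Qed.

Lemma rows3_orthogonal u v w z : row_free (rows3 u v w) ->
  dot u z = 0 -> dot v z = 0 -> dot w z = 0 -> z = 0.
Proof.
move=> U uz vz wz; apply/eqP; apply: contraTT U => z0.
by apply: (orthogonal_dependent z0); apply: ord3P; rewrite row_rows3.
Qed.

Lemma dotxx_eq0 w : (dot w w == 0) = (w == 0).
Proof.
apply/idP/idP => [|/eqP->]; last by rewrite dot0l.
rewrite dotE psumr_eq0 => [/allP H|i _]; last by rewrite -expr2 sqr_ge0.
apply/eqP/rowP => i; rewrite mxE; apply/eqP.
by have := H i (mem_index_enum i); rewrite mulf_eq0 orbb.
Qed.

(** The factor may be 0, which is why symmetry needs a nonzero target. *)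
Definition par d d' := exists t, d' = t *: d.

Lemma par_refl d : par d d.
Proof. by exists 1; rewrite scale1r. Qed.

Lemma par_sym d d' : d' != 0 -> par d d' -> par d' d.
Proof.
move=> d0 [t dt]; exists t^-1; rewrite dt scalerA mulVf ?scale1r //.
by apply: contra_neq d0 => t0; rewrite dt t0 scale0r.
Qed.

Lemma par_trans d d' d'' : par d d' -> par d' d'' -> par d d''.
Proof. by move=> [t ->] [t' ->]; exists (t' * t); rewrite scalerA. Qed.

Lemma par_dot d d' w : par d d' -> dot d w = 0 -> dot d' w = 0.
Proof. by move=> [t ->] dw; rewrite dotZl dw mulr0. Qed.

Lemma nonpar_comb d d' al be : d != 0 -> ~ par d d' ->
  al *: d + be *: d' = 0 -> al = 0 /\ be = 0.
Proof.
move=> d0 dd' E0; have be0 : be = 0.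
  apply/eqP; apply: contra_notT dd' => b0; exists (- (al / be)).
  apply: (scalerI b0); rewrite scalerA mulrN mulrC divfK // scaleNr.
  by apply/eqP; rewrite -addr_eq0 addrC E0.
split=> //; move/eqP: E0; rewrite be0 scale0r addr0 scaler_eq0 (negPf d0) orbF.
by move/eqP.
Qed.

Lemma nonpar_normal_free d d' w : d != 0 -> ~ par d d' -> w != 0 ->
  dot d w = 0 -> dot d' w = 0 -> row_free (rows3 d d' w).
Proof.
move=> d0 dd' w0 dw d'w; apply: rows3_free => al be ga E0.
have ga0 : ga = 0.
  have := congr1 (dot ^~ w) E0; rewrite !dotDl !dotZl dw d'w dot0l !mulr0 !add0r.
  by move/eqP; rewrite mulf_eq0 dotxx_eq0 (negPf w0) orbF => /eqP.
by move: E0; rewrite ga0 scale0r addr0 => /(nonpar_comb d0 dd')[].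
Qed.

Lemma normal_unique d d' w w' : d != 0 -> ~ par d d' -> w != 0 ->
  dot d w = 0 -> dot d' w = 0 -> dot d w' = 0 -> dot d' w' = 0 ->
  exists t, w' = t *: w.
Proof.
move=> d0 dd' w0 dw d'w dw' d'w'; exists (dot w w' / dot w w).
apply/eqP; rewrite -subr_eq0; apply/eqP.
apply: (rows3_orthogonal (nonpar_normal_free d0 dd' w0 dw d'w)).
- by rewrite dotBr dotZr dw dw' mulr0 subrr.
- by rewrite dotBr dotZr d'w d'w' mulr0 subrr.
- by rewrite dotBr dotZr divfK ?subrr // dotxx_eq0.
Qed.

End LinearAlgebra.

(** * Directions of antipodal segments *)

Section Antipodal.
Variables (R : realFieldType) (I : eqType).
Local Notation E := 'rV[R]_3.
Variables (a b : I -> E) (w : I -> I -> E) (c : I -> I -> R).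
Local Notation d i := (b i - a i).
Local Notation F i j x := (dot x (w i j) + c i j).
Hypothesis d_neq0 : forall i, d i != 0.
Hypothesis F_top : forall i j, i != j -> F i j (a i) = 1 /\ F i j (b i) = 1.
Hypothesis F_bot : forall i j, i != j -> F i j (a j) = 0 /\ F i j (b j) = 0.
Hypothesis F_01 : forall i j k, i != j ->
  0 <= F i j (a k) <= 1 /\ 0 <= F i j (b k) <= 1.
Implicit Types (i j k l : I) (x : E).

Lemma w_top i j : i != j -> dot (d i) (w i j) = 0.
Proof. by move=> /F_top; rewrite dotBl; lra. Qed.

Lemma w_bot i j : i != j -> dot (d j) (w i j) = 0.
Proof. by move=> /F_bot; rewrite dotBl; lra. Qed.

Lemma w_neq0 i j : i != j -> w i j != 0.
Proof.
move=> ij; apply/eqP => w0; have := F_top ij; have := F_bot ij.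
by rewrite w0 !(dotC _ 0) !dot0l; lra.
Qed.

Local Notation npar i j := (~ par (d i) (d j)).

Lemma npar_sym i j : npar i j -> npar j i.
Proof. by move=> H /(par_sym (d_neq0 i)). Qed.

Lemma npar_neq i j : npar i j -> i != j.
Proof. by move=> H; apply/eqP => ij; apply: H; rewrite ij; exact: par_refl. Qed.

(** Both F_ij and F_kj vanish on the segment j and their normals are proportional, so F_kj = t F_ij.
    The value of F_kj at [a i] is t, hence t <= 1, while t F_ij = 1 at [a k]; as F_ij <= 1, equality
    holds. *)
Lemma F_coplanar i j k : npar i j -> npar j k -> dot (d k) (w i j) = 0 ->
  F i j (a k) = 1.
Proof.
move=> /npar_sym Pji Pjk wk; have ji := npar_neq Pji; have jk := npar_neq Pjk.
have ij : i != j by rewrite eq_sym.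
have kj : k != j by rewrite eq_sym.
have [t tE] := normal_unique (d_neq0 j) Pjk (w_neq0 ij) (w_bot ij) wk
  (w_bot kj) (w_top kj).
have [T1 _] := F_top kj; have [B1 _] := F_bot kj; have [/andP[u1 u2] _] := F_01 i kj.
have [T2 _] := F_top ij; have [B2 _] := F_bot ij; have [/andP[v1 v2] _] := F_01 k ij.
have c1 : c k j = - t * dot (a j) (w i j) by rewrite tE dotZr in B1; lra.
have c2 : c i j = - dot (a j) (w i j) by lra.
move: T1 u1 u2 T2 v1 v2; rewrite tE !dotZr c1 c2.
move: (dot (a k) _) (dot (a j) _) (dot (a i) _) => p q r T1 u1 u2 T2 v1 v2.
have {}T1 : t * (p - q) = 1 by lra.
have {}T2 : r = 1 + q by lra.
rewrite T2 in u1 u2; have {u1 u2}[t0 t1] : 0 <= t /\ t <= 1 by split; lra.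
nra.
Qed.

(** Otherwise [F_coplanar] puts the segments i and k on the same level of F_ij, whereas F_ik, whose
    normal would be proportional to [w i j], separates them. *)
Lemma npar_not_coplanar i j k : npar i j -> npar j k -> npar k i ->
  dot (d k) (w i j) != 0.
Proof.
move=> Pij Pjk /npar_sym Pik; apply/eqP => wk.
have Fk := F_coplanar Pij Pjk wk.
have ij := npar_neq Pij; have ik := npar_neq Pik.
have [t tE] := normal_unique (d_neq0 i) Pik (w_neq0 ij) (w_top ij) wk
  (w_top ik) (w_bot ik).
have [T1 _] := F_top ik; have [B1 _] := F_bot ik.
have [T2 _] := F_top ij; have [B2 _] := F_bot ij.
move: T1 B1; rewrite tE !dotZr => T1 B1.
have E1 : dot (a i) (w i j) = dot (a k) (w i j) by lra.
by move: T1; rewrite E1; lra.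
Qed.

(** [w j k] kills the directions j and k but not i, so it isolates one coefficient of a linear
    relation; the others follow cyclically. *)
Lemma npar_free i j k : npar i j -> npar j k -> npar k i ->
  row_free (rows3 (d i) (d j) (d k)).
Proof.
move=> Pij Pjk Pki; apply: rows3_free => al be ga E0.
have ij := npar_neq Pij; have jk := npar_neq Pjk; have ki := npar_neq Pki.
split.
- have := congr1 (fun x : E => dot x (w j k)) E0;
    rewrite /= !dotDl !dotZl dot0l w_top // w_bot //.
  rewrite !mulr0 !addr0 => /eqP.
  by rewrite mulf_eq0 (negPf (npar_not_coplanar Pjk Pki Pij)) orbF => /eqP.
- have := congr1 (fun x : E => dot x (w k i)) E0;
    rewrite /= !dotDl !dotZl dot0l w_top // w_bot //.
  rewrite !mulr0 !addr0 add0r => /eqP.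
  by rewrite mulf_eq0 (negPf (npar_not_coplanar Pki Pij Pjk)) orbF => /eqP.
- have := congr1 (fun x : E => dot x (w i j)) E0;
    rewrite /= !dotDl !dotZl dot0l w_top // w_bot //.
  rewrite !mulr0 !add0r => /eqP.
  by rewrite mulf_eq0 (negPf (npar_not_coplanar Pij Pjk Pki)) orbF => /eqP.
Qed.

(** [w i l] is orthogonal to [d i], and the vectors orthogonal to [d i] are spanned by [w k i] and
    [w i j]. The constant is fixed at [a i], where F_il, F_ki and F_ij are 1, 0 and 1. *)
Lemma F_fourth i j k l : npar i j -> npar j k -> npar k i -> i != l ->
  exists be ga, be * dot (d l) (w k i) + ga * dot (d l) (w i j) = 0 /\
    forall x, F i l x = 1 + be * F k i x + ga * (F i j x - 1).
Proof.
move=> Pij Pjk Pki il.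
have ij := npar_neq Pij; have jk := npar_neq Pjk; have ki := npar_neq Pki.
have U := npar_free Pij Pjk Pki.
have Nk := npar_not_coplanar Pij Pjk Pki; have Nj := npar_not_coplanar Pki Pij Pjk.
pose be := dot (d j) (w i l) / dot (d j) (w k i).
pose ga := dot (d k) (w i l) / dot (d k) (w i j).
have wE : w i l = be *: w k i + ga *: w i j.
  apply/eqP; rewrite -subr_eq0; apply/eqP; apply: (rows3_orthogonal U).
  - by rewrite dotBr dotDr !dotZr !w_top // w_bot //; lra.
  - by rewrite dotBr dotDr !dotZr (w_bot ij) mulr0 addr0 divfK // subrr.
  - by rewrite dotBr dotDr !dotZr (w_top ki) mulr0 add0r divfK // subrr.
exists be, ga; split.
  by rewrite -!dotZr -dotDr -wE w_bot.
move=> x; have [F1 _] := F_top il; have [F2 _] := F_bot ki; have [F3 _] := F_top ij.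
have -> : c k i = - dot (a i) (w k i) by lra.
have -> : c i j = 1 - dot (a i) (w i j) by lra.
by move: F1; rewrite wE !dotDr !dotZr; lra.
Qed.

Lemma fourth_slabP i j k l : npar i j -> npar j k -> npar k i ->
  i != l ->
  fourth_slab (dot (d l) (w k i)) (dot (d l) (w i j)) (F k i (a l)) (F i j (a l))
    (F k i (a j)) (F i j (a k)).
Proof.
move=> Pij Pjk Pki il.
have ij := npar_neq Pij; have ki := npar_neq Pki.
have [be [ga [E0 EF]]] := F_fourth Pij Pjk Pki il.
exists be, ga; split=> //.
- by have [] := F_01 j il; rewrite EF (F_bot ij).1; lra.
- by have [] := F_01 k il; rewrite EF (F_top ki).1; lra.
- by have [] := F_bot il; rewrite EF.
Qed.

Lemma three_directions i j k l : npar i j -> npar j k -> npar k i ->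
  i != l -> j != l -> k != l -> False.
Proof.
move=> Pij Pjk Pki il jl kl.
have ij := npar_neq Pij; have jk := npar_neq Pjk; have ki := npar_neq Pki.
have Fd i' j' : F i' j' (a l) + dot (d l) (w i' j') = F i' j' (b l).
  by rewrite dotBl; lra.
apply: (no_fourth_slab _ _ _ _ _ _ _ _ _ _ (fourth_slabP Pij Pjk Pki il)
   (fourth_slabP Pjk Pki Pij jl) (fourth_slabP Pki Pij Pjk kl));
  rewrite ?Fd; try by [apply: (F_01 _ _).1 | apply: (F_01 _ _).2].
(* It remains to see that the fourth direction has a nonzero coordinate: expanded in the basis of
   the other three directions, it would vanish otherwise. *)
apply: contraT; rewrite !negb_or !negbK => /and3P[/eqP d1 /eqP d2 /eqP d3].
have /eqP := d_neq0 l; case.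
have [al [be [ga dE]]] := rows3_comb (npar_free Pij Pjk Pki) (d l).
move: d1 d2 d3; rewrite dE !dotDl !dotZl (w_top ij) (w_bot ij) (w_top jk) (w_bot jk).
rewrite (w_top ki) (w_bot ki) !mulr0 !addr0 !add0r.
move=> /eqP; rewrite mulf_eq0 (negPf (npar_not_coplanar Pjk Pki Pij)) orbF => /eqP->.
move=> /eqP; rewrite mulf_eq0 (negPf (npar_not_coplanar Pki Pij Pjk)) orbF => /eqP->.
move=> /eqP; rewrite mulf_eq0 (negPf (npar_not_coplanar Pij Pjk Pki)) orbF => /eqP->.
by rewrite !scale0r !addr0.
Qed.

Lemma F_swap i j x : npar i j -> F j i x = 1 - F i j x.
Proof.
move=> Pij; have ij := npar_neq Pij; have ji : j != i by rewrite eq_sym.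
have [t tE] := normal_unique (d_neq0 i) Pij (w_neq0 ij) (w_top ij) (w_bot ij)
  (w_bot ji) (w_top ji).
have [T1 _] := F_top ij; have [B1 _] := F_bot ij.
have [T2 _] := F_top ji; have [B2 _] := F_bot ji.
move: T2 B2; rewrite tE !dotZr => T2 B2.
have cE : c i j = 1 - dot (a i) (w i j) by lra.
have c'E : c j i = - (t * dot (a i) (w i j)) by lra.
rewrite cE c'E in B1 T2 *;
  have t1 : t * (dot (a j) (w i j) - dot (a i) (w i j)) = 1 by lra.
have D1 : dot (a j) (w i j) - dot (a i) (w i j) = - 1 by lra.
have -> : t = - 1 by rewrite D1 in t1; lra.
lra.
Qed.

Lemma F_class_top i j k : npar i j -> par (d i) (d k) -> F i j (a k) = 1.
Proof.
move=> Pij Pik; have ij := npar_neq Pij.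
apply: F_coplanar (par_dot Pik (w_top ij)) => // Pjk; apply: Pij.
by apply: par_trans Pik _; apply: par_sym.
Qed.

Lemma F_class_bot i j k : npar i j -> par (d j) (d k) -> F i j (a k) = 0.
Proof.
by move=> Pij Pjk; have := F_class_top (npar_sym Pij) Pjk; rewrite F_swap //; lra.
Qed.

(** Applied to a linear relation, F_ij and F_ik give |al| <= |be| <= |al| with opposite signs, so be
    = - al; then F_jk, which differs by 1 between j and k, gives al = 0. *)
Lemma par_free i j k : i != j -> j != k -> k != i ->
  par (d i) (d j) -> par (d i) (d k) ->
  row_free (rows3 (a j - a i) (a k - a i) (d i)).
Proof.
move=> ij jk ki Pij Pik; apply: rows3_free => al be ga E0.
have FE p q : p != q -> par (d i) (d p) ->
    al * (F p q (a j) - F p q (a i)) + be * (F p q (a k) - F p q (a i)) = 0.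
  move=> pq Pip; have di : dot (d i) (w p q) = 0.
    by apply: par_dot (w_top pq); apply: par_sym.
  have := congr1 (fun x : E => dot x (w p q)) E0.
  by rewrite /= 2!dotDl !dotZl di dot0l mulr0 addr0 !dotBl; lra.
have ik : i != k by rewrite eq_sym.
have := FE _ _ ij (par_refl _); have := FE _ _ ik (par_refl _).
have := FE _ _ jk Pij.
rewrite (F_top ij).1 (F_bot ij).1 (F_top ik).1 (F_bot ik).1 (F_top jk).1 (F_bot jk).1.
have [/andP[]] := F_01 k ij; have [/andP[]] := F_01 j ik; have [/andP[]] := F_01 i jk.
move: (F j k (a i)) (F i k (a j)) (F i j (a k)) => r s t r0 r1 _ s0 s1 _ t0 t1 _.
move=> E1 E2 E3.
have al0 : al = 0.
  have bE : be = - (al * (1 - s)) by lra.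
  have aE : al = - (be * (1 - t)) by lra.
  have [?|?|//] := ltgtP al 0.
    have b0 : 0 <= be by nra.
    have b1 : be <= - al by nra.
    have b2 : - al <= be by nra.
    have bE' : be = - al by lra.
    by move: E1; rewrite bE'; lra.
  have b0 : be <= 0 by nra.
  have b1 : - al <= be by nra.
  have b2 : be <= - al by nra.
  have bE' : be = - al by lra.
  by move: E1; rewrite bE'; lra.
have be0 : be = 0 by move: E2; rewrite al0; lra.
split=> //; move/eqP: E0.
by rewrite al0 be0 !scale0r !add0r scaler_eq0 (negPf (d_neq0 i)) orbF => /eqP.
Qed.

Lemma class_le2 i j k l : npar i j -> par (d i) (d k) -> par (d i) (d l) ->
  i != k -> k != l -> l != i -> False.
Proof.
move=> Pij Pik Pil ik kl li; have ij := npar_neq Pij.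
apply/negP: (w_neq0 ij); apply/negPn/eqP.
have [T1 _] := F_top ij.
apply: (rows3_orthogonal (par_free ik kl li Pik Pil)) (w_top ij).
- by have := F_class_top Pij Pik; rewrite dotBl; lra.
- by have := F_class_top Pij Pil; rewrite dotBl; lra.
Qed.

Lemma par_parallelogram i j k l :
  i != j -> j != k -> k != i -> i != l -> j != l -> k != l ->
  par (d i) (d j) -> par (d i) (d k) -> par (d i) (d l) ->
  exists de, [\/ a l = a i + a j - a k + de *: d i, a l = a i + a k - a j + de *: d i
               | a l = a j + a k - a i + de *: d i].
Proof.
move=> ij jk ki il jl kl Pij Pik Pil.
have [be [ga [de lE]]] := rows3_comb (par_free ij jk ki Pij Pik) (a l - a i).
exists de; pose al := 1 - be - ga.
have aE : a l = al *: a i + be *: a j + ga *: a k + de *: d i.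
  rewrite -[LHS](subrK (a i)) lE /al; apply/rowP => m; rewrite !mxE; ring.
(* The normal [w p q] kills the common direction, so only the barycentric coordinates modulo that
   direction matter. *)
have FE p q : p != q -> par (d i) (d p) ->
    F p q (a l) = al * F p q (a i) + be * F p q (a j) + ga * F p q (a k).
  move=> pq Pip; have di : dot (d i) (w p q) = 0.
    by apply: par_dot (w_top pq); apply: par_sym.
  by rewrite aE !dotDl !dotZl di /al; ring.
have ik : i != k by rewrite eq_sym.
have : [\/ [/\ al = 1, be = 1 & ga = -1], [/\ al = 1, be = -1 & ga = 1]
    | [/\ al = -1, be = 1 & ga = 1]].
  apply: antipodal_barycentric; first by rewrite /al; lra.
  - exists (F i j (a k)); first exact: (F_01 _ ij).1.
    have := (F_01 l ij).1; rewrite (FE _ _ ij (par_refl _)) (F_top ij).1 (F_bot ij).1.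
    by rewrite mulr1 mulr0 addr0.
  - exists (F i k (a j)); first exact: (F_01 _ ik).1.
    have := (F_01 l ik).1; rewrite (FE _ _ ik (par_refl _)) (F_top ik).1 (F_bot ik).1.
    by rewrite mulr1 mulr0 addr0.
  - exists (F j k (a i)); first exact: (F_01 _ jk).1.
    have := (F_01 l jk).1; rewrite (FE _ _ jk Pij) (F_top jk).1 (F_bot jk).1.
    by rewrite mulr1 mulr0 addr0 [be + _]addrC.
  - exists (F i l (a j)), (F i l (a k)); split; [exact: (F_01 _ il).1..|].
    by have := (F_bot il).1; rewrite (FE _ _ il (par_refl _)) (F_top il).1; lra.
  - exists (F j l (a i)), (F j l (a k)); split; [exact: (F_01 _ jl).1..|].
    by have := (F_bot jl).1; rewrite (FE _ _ jl Pij) (F_top jl).1; lra.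
  - exists (F k l (a i)), (F k l (a j)); split; [exact: (F_01 _ kl).1..|].
    by have := (F_bot kl).1; rewrite (FE _ _ kl Pik) (F_top kl).1; lra.
have E1 (x y z t : E) : 1 *: x + 1 *: y + -1 *: z + t = x + y - z + t :> E.
  by rewrite !scale1r scaleN1r.
have E2 (x y z t : E) : 1 *: x + -1 *: y + 1 *: z + t = x + z - y + t :> E.
  by rewrite !scale1r scaleN1r; congr (_ + _); rewrite addrAC.
have E3 (x y z t : E) : -1 *: x + 1 *: y + 1 *: z + t = y + z - x + t :> E.
  by rewrite !scale1r scaleN1r; congr (_ + _); rewrite -addrA addrC.
case=> [[E4 E5 E6]|[E4 E5 E6]|[E4 E5 E6]]; rewrite E4 E5 E6 in aE.
- by constructor 1; rewrite aE E1.
- by constructor 2; rewrite aE E2.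
- by constructor 3; rewrite aE E3.
Qed.

(** Both l and m complete the triangle i, j, k to a parallelogram. Modulo the direction they
    coincide, or some vertex p of the triangle is their midpoint; then F_pl would be 2 at [a m]. *)
Lemma par_le4 i j k l m :
  i != j -> j != k -> k != i -> i != l -> j != l -> k != l ->
  i != m -> j != m -> k != m -> l != m ->
  par (d i) (d j) -> par (d i) (d k) -> par (d i) (d l) -> par (d i) (d m) ->
  False.
Proof.
move=> ij jk ki il jl kl im jm km lm Pij Pik Pil Pim.
have [de lE] := par_parallelogram ij jk ki il jl kl Pij Pik Pil.
have [de' mE] := par_parallelogram ij jk ki im jm km Pij Pik Pim.
have w0 p q : p != q -> par (d i) (d p) -> dot (d i) (w p q) = 0.
  by move=> pq Pip; apply: par_dot (w_top pq); apply: par_sym.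
have N p : p != l -> par (d i) (d p) -> forall ep,
    a l + a m <> a p + a p + ep *: d i.
  move=> pl Pip ep /(congr1 (fun x : E => dot x (w p l))).
  rewrite /= !dotDl !dotZl w0 // mulr0 addr0.
  by have [/andP[]] := F_01 m pl; have [] := F_top pl; have [] := F_bot pl; lra.
have N' : forall ep, a l <> a m + ep *: d i.
  move=> ep /(congr1 (fun x : E => dot x (w l m))).
  rewrite /= !dotDl !dotZl w0 // mulr0 addr0.
  by have [] := F_top lm; have [] := F_bot lm; lra.
case: lE => lE; case: mE => mE; move: N'; rewrite lE mE => N'.
- apply: (N' (de - de')); apply/rowP => p; rewrite !mxE; ring.
- apply: (N i il (par_refl _) (de + de')); rewrite lE mE.
  by apply/rowP => p; rewrite !mxE; ring.
- apply: (N j jl Pij (de + de')); rewrite lE mE.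
  by apply/rowP => p; rewrite !mxE; ring.
- apply: (N i il (par_refl _) (de + de')); rewrite lE mE.
  by apply/rowP => p; rewrite !mxE; ring.
- apply: (N' (de - de')); apply/rowP => p; rewrite !mxE; ring.
- apply: (N k kl Pik (de + de')); rewrite lE mE.
  by apply/rowP => p; rewrite !mxE; ring.
- apply: (N j jl Pij (de + de')); rewrite lE mE.
  by apply/rowP => p; rewrite !mxE; ring.
- apply: (N k kl Pik (de + de')); rewrite lE mE.
  by apply/rowP => p; rewrite !mxE; ring.
- apply: (N' (de - de')); apply/rowP => p; rewrite !mxE; ring.
Qed.

Lemma par_or_par i j k l : npar i j -> i != k -> j != k -> i != l -> j != l ->
  k != l -> par (d i) (d k) \/ par (d j) (d k).
Proof.
move=> Pij ik jk il jl kl.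
have [|Pik] := EM (par (d i) (d k)); first by left.
have [|Pjk] := EM (par (d j) (d k)); first by right.
by case: (three_directions Pij Pjk (npar_sym Pik) il jl kl).
Qed.

Lemma npar_2_2 i j k l : npar i j -> i != k -> j != k -> i != l -> j != l ->
  k != l -> (par (d i) (d k) /\ par (d j) (d l)) \/
            (par (d i) (d l) /\ par (d j) (d k)).
Proof.
move=> Pij ik jk il jl kl; have lk : l != k by rewrite eq_sym.
have [li lj] : l != i /\ l != j by rewrite eq_sym il eq_sym jl.
have [Pik|Pjk] := par_or_par Pij ik jk il jl kl;
  have [Pil|Pjl] := par_or_par Pij il jl ik jk lk; try tauto.
- by case: (class_le2 Pij Pik Pil).
- by case: (class_le2 (npar_sym Pij) Pjk Pjl).
Qed.

Lemma npar_le4 i j k l m : npar i j -> i != k -> j != k -> i != l -> j != l ->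
  i != m -> j != m -> k != l -> k != m -> l != m -> False.
Proof.
move=> Pij ik jk il jl im jm kl km lm.
have [li lj] : l != i /\ l != j by rewrite eq_sym il eq_sym jl.
have [mi mj] : m != i /\ m != j by rewrite eq_sym im eq_sym jm.
have Pji := npar_sym Pij.
have [[Pik Pjl]|[Pil Pjk]] := npar_2_2 Pij ik jk il jl kl.
  have [[_ Pjm]|[Pim _]] := npar_2_2 Pij ik jk im jm km.
    exact: (class_le2 Pji Pjl Pjm jl lm mj).
  exact: (class_le2 Pij Pik Pim ik km mi).
have [[_ Pjm]|[Pim _]] := npar_2_2 Pij ik jk im jm km.
  exact: (class_le2 Pji Pjk Pjm jk km mj).
exact: (class_le2 Pij Pil Pim il lm mi).
Qed.

Lemma antipodal_le4 i j k l m :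
  i != j -> j != k -> k != i -> i != l -> j != l -> k != l ->
  i != m -> j != m -> k != m -> l != m -> False.
Proof.
move=> ij jk ki il jl kl im jm km lm.
have [ji kj ik] : [/\ j != i, k != j & i != k] by split; rewrite eq_sym.
have [li lj lk] : [/\ l != i, l != j & l != k] by rewrite eq_sym il eq_sym jl eq_sym kl.
have [Pij|Pij] := EM (par (d i) (d j)); last first.
  by apply: (@npar_le4 i j k l m).
have [Pik|Pik] := EM (par (d i) (d k)); last first.
  by apply: (@npar_le4 i k j l m).
have [Pil|Pil] := EM (par (d i) (d l)); last first.
  by apply: (@npar_le4 i l j k m).
have [Pim|Pim] := EM (par (d i) (d m)); last first.
  by apply: (@npar_le4 i m j k l) => //; rewrite eq_sym.
exact: (@par_le4 i j k l m).
Qed.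

End Antipodal.

(** * Hulls and supporting planes *)

Section Hulls.
Variable R : realType.
Local Notation E := 'rV[R]_3.
Implicit Types (A B P : set E) (a b p q u v w x y : E) (c t : R).

Lemma convex_setP A : @convex_set R E A <->
  forall x y t, 0 <= t <= 1 -> A x -> A y -> A ((1 - t) *: x + t *: y).
Proof.
split=> [cA x y t /andP[t0 t1] /mem_set Ax /mem_set Ay|
  cA x y t /set_mem Ax /set_mem Ay].
  have := cA y x (Itv01 t0 t1) Ay Ax => /set_mem.
  by rewrite [X in A X]addrC.
apply: mem_set; rewrite [X in A X]addrC /=.
by apply: (cA y x t%:num) => //; apply/andP; split; [exact: ge0|exact: le1].
Qed.

Lemma conv_hull_convex A : convex_set (conv_hull A).
Proof.
apply/convex_setP => x y t t01 Ax Ay B HB.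
by move/convex_setP: (HB.1) => cB; apply: cB (Ax _ HB) (Ay _ HB).
Qed.

Lemma sub_conv_hull A : A `<=` conv_hull A.
Proof. exact: sub_gen_smallest. Qed.

Lemma conv_hull_sub A B : convex_set B -> A `<=` B -> conv_hull A `<=` B.
Proof. exact: smallest_sub. Qed.

Lemma conv_hull_min A B : A `<=` conv_hull B -> conv_hull A `<=` conv_hull B.
Proof. by move=> AB; apply: conv_hull_sub => //; exact: conv_hull_convex. Qed.

Lemma aff_hull_affine A : affine_set (aff_hull A).
Proof.
by move=> x y t Ax Ay B HB; apply: HB.1 (Ax _ HB) (Ay _ HB).
Qed.

Lemma sub_aff_hull A : A `<=` aff_hull A.
Proof. exact: sub_gen_smallest. Qed.

Lemma aff_hull_sub A B : affine_set B -> A `<=` B -> aff_hull A `<=` B.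
Proof. exact: smallest_sub. Qed.

Lemma aff_hull_id A : affine_set A -> aff_hull A = A.
Proof. exact: smallest_id. Qed.

Lemma conv_sub_aff_hull A : conv_hull A `<=` aff_hull A.
Proof.
apply: conv_hull_sub; last exact: sub_aff_hull.
by apply/convex_setP => x y t _; exact: aff_hull_affine.
Qed.

Lemma aff_conv_hull A : aff_hull (conv_hull A) = aff_hull A.
Proof.
apply/seteqP; split.
  by apply: aff_hull_sub; [exact: aff_hull_affine|exact: conv_sub_aff_hull].
apply: aff_hull_sub; first exact: aff_hull_affine.
by move=> x Ax; apply: sub_aff_hull; apply: sub_conv_hull.
Qed.

Lemma conv_hull2 a b :
  conv_hull [set a; b] = [set a + t *: (b - a) | t in [set t | 0 <= t <= 1]].
Proof.
have seg t : a + t *: (b - a) = (1 - t) *: a + t *: b.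
  by apply/rowP => i; rewrite !mxE; ring.
apply/seteqP; split=> [|_ [t /= t01 <-]]; last first.
  rewrite seg; move/convex_setP: (@conv_hull_convex [set a; b]); apply=> //;
    by apply: sub_conv_hull; by [left|right].
apply: conv_hull_sub; last first.
  move=> x [->|->]; [exists 0|exists 1]; rewrite /= ?lexx ?ler01 //.
    by rewrite scale0r addr0.
  by rewrite scale1r addrC subrK.
apply/convex_setP => _ _ t /andP[t0 t1] [r /andP[r0 r1] <-] [s /andP[s0 s1] <-].
exists ((1 - t) * r + t * s); first by apply/andP; split; nra.
by apply/rowP => i; rewrite !mxE; ring.
Qed.

Lemma aff_hull2 a b : aff_hull [set a; b] = [set a + t *: (b - a) | t in setT].
Proof.
have seg t : a + t *: (b - a) = (1 - t) *: a + t *: b.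
  by apply/rowP => i; rewrite !mxE; ring.
apply/seteqP; split=> [|_ [t /= _ <-]]; last first.
  by rewrite seg; apply: aff_hull_affine; apply: sub_aff_hull; by [left|right].
apply: aff_hull_sub; last first.
  move=> x [->|->]; [exists 0|exists 1]; rewrite //=.
    by rewrite scale0r addr0.
  by rewrite scale1r addrC subrK.
move=> _ _ t [r _ <-] [s _ <-]; exists ((1 - t) * r + t * s) => //.
by apply/rowP => i; rewrite !mxE; ring.
Qed.

Lemma dot_aff x y t w c :
  dot ((1 - t) *: x + t *: y) w + c = (1 - t) * (dot x w + c) + t * (dot y w + c).
Proof. by rewrite dotDl !dotZl; ring. Qed.

Lemma affine_level w c t0 : affine_set [set x : E | dot x w + c = t0].
Proof. by move=> x y t /= xc yc; rewrite dot_aff xc yc; ring. Qed.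

Lemma conv_hull_01 A w c : (forall x, A x -> 0 <= dot x w + c <= 1) ->
  forall x, conv_hull A x -> 0 <= dot x w + c <= 1.
Proof.
move=> A01; apply: conv_hull_sub => //.
apply/convex_setP => x y t /andP[t0 t1] /= /andP[x0 x1] /andP[y0 y1].
by rewrite dot_aff; apply/andP; split; nra.
Qed.

Lemma conv_hull_face A B w c : convex_set A ->
  (forall x, A x -> dot x w + c = 1) ->
  (forall x, B x -> A x \/ dot x w + c < 1) ->
  conv_hull B `&` [set x | dot x w + c = 1] `<=` A.
Proof.
move=> /convex_setP cA A1 BA x [Bx /= Fx].
(* [A] together with the open half-space below the level 1 is convex. *)
suff [//|] : A x \/ dot x w + c < 1 by rewrite Fx ltxx.
move: x Bx {Fx}; apply: conv_hull_sub => //.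
apply/convex_setP => x y t t01 /=.
have [->|t0] := eqVneq t 0; first by rewrite subr0 scale1r scale0r addr0.
have [->|t1] := eqVneq t 1; first by rewrite subrr scale1r scale0r add0r.
have [{}t0 {}t1] : 0 < t /\ 0 < 1 - t.
  case/andP: t01 => t0' t1'; split; first by rewrite lt_neqAle eq_sym t0.
  by rewrite subr_gt0 lt_neqAle t1.
case=> [Ax|Fx] [Ay|Fy]; first by left; apply: cA.
- by right; rewrite dot_aff (A1 _ Ax); nra.
- by right; rewrite dot_aff (A1 _ Ay); nra.
- by right; rewrite dot_aff; nra.
Qed.

Lemma planeE w c t0 : [set x : E | dot x w + c = t0] = plane w (t0 - c).
Proof.
by apply/seteqP; split=> x; rewrite /plane /= -/(dot x w); lra.
Qed.

Lemma dot_orth_scale u w : u != 0 ->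
  (forall y, dot y u = 0 -> dot y w = 0) -> exists t, w = t *: u.
Proof.
move=> u0 H; pose t := dot u w / dot u u; exists t.
have zu : dot (w - t *: u) u = 0.
  by rewrite dotBl dotZl dotC divfK ?subrr // dotxx_eq0.
apply/eqP; rewrite -subr_eq0 -dotxx_eq0.
by rewrite dotBr dotZr zu (H _ zu) mulr0 subr0.
Qed.

(** This replaces pairs of planes by one affine function, the form in which antipodality is used
    from here on. *)
Lemma parallel_supportingP P H H' : parallel_supporting_planes P H H' <->
  exists w c, [/\ H = [set x | dot x w + c = 1], H' = [set x | dot x w + c = 0],
    forall x, P x -> 0 <= dot x w + c <= 1, P `&` H !=set0 & P `&` H' !=set0].
Proof.
split.
  move=> [[u [c [u0 HE Pu PH]]] [u' [c' [u0' HE' Pu' PH']]] [v par] HH'].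
  (* The translation from H to H' carries directions of H to directions of H', so [u'] vanishes on
     the orthogonal complement of [u]. *)
  have [lam lamE] : exists lam, u' = lam *: u.
    apply: dot_orth_scale => // y yu.
    have [x0 [_ Hx0]] := PH.
    have aH x : H x -> H' (x + v).
      have aE w e : aff_hull (plane w e) = plane w e.
        have := @affine_level w 0 e; rewrite planeE subr0; exact: aff_hull_id.
      by move: par; rewrite HE HE' !aE => -> Hx; exists x.
    have Hy : H (x0 + y).
      by move: Hx0; rewrite HE /plane /= -!/(dot _ _) dotDl yu addr0.
    have := aH _ Hy; have := aH _ Hx0.
    by rewrite HE' /plane /= -!/(dot _ _) !dotDl; lra.
  have lam0 : lam != 0 by apply: contra_neq u0' => l0; rewrite lamE l0 scale0r.
  have H'E : H' = plane u (c' / lam).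
    rewrite HE' lamE; apply/seteqP; split=> x; rewrite /plane /= -!/(dot _ _) dotZr.
      by move=> <-; rewrite mulrC mulKf.
    by move=> ->; rewrite mulrC divfK.
  set m := c' / lam in H'E.
  have c'E : c' = lam * m by rewrite /m mulrC divfK.
  have {}Pu' x : P x -> lam * dot x u <= lam * m.
    by move=> /Pu'; rewrite -!/(dot _ _) lamE dotZr c'E.
  have {}Pu x : P x -> dot x u <= c by exact: Pu.
  have mc : m != c by apply: contra_not_neq HH' => mc; rewrite HE H'E mc.
  have [p [Pp Hp]] := PH; have [q [Pq Hq]] := PH'.
  have pc : dot p u = c by move: Hp; rewrite HE.
  have qm : dot q u = m by move: Hq; rewrite H'E.
  (* For lam > 0 both planes would be the highest level of [u] on P, hence equal. *)
  have lamN : lam < 0.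
    rewrite lt_neqAle lam0 leNgt; apply/negP => lp.
    have := Pu' p Pp; rewrite pc ler_pM2l // => cm.
    by have := Pu q Pq; rewrite qm => mc'; case/eqP: mc; apply/eqP;
      rewrite eq_le cm mc'.
  have {}Pu' x : P x -> m <= dot x u by move=> /Pu'; rewrite ler_nM2l.
  have lmc : 0 < c - m by rewrite subr_gt0 lt_neqAle mc -pc Pu'.
  exists ((c - m)^-1 *: u), (- (m / (c - m))).
  have FE x : dot x ((c - m)^-1 *: u) + - (m / (c - m)) = (dot x u - m) / (c - m).
    by rewrite dotZr mulrBl mulrC.
  have cm0 : c - m != 0 by rewrite gt_eqF.
  split=> //.
  - rewrite HE; apply/seteqP; split=> x; rewrite /plane /= -/(dot _ _) FE.
      by move=> ->; rewrite divff.
    by move/(congr1 ( *%R^~ (c - m))); rewrite divfK // mul1r; lra.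
  - rewrite H'E; apply/seteqP; split=> x; rewrite /plane /= -/(dot _ _) FE.
      by move=> ->; rewrite subrr mul0r.
    by move/(congr1 ( *%R^~ (c - m))); rewrite divfK // mul0r; lra.
  - move=> x Px; rewrite FE ler_pdivlMr // mul0r ler_pdivrMr // mul1r.
    by have := Pu x Px; have := Pu' x Px; lra.
move=> [w [c [HE HE' P01 PH PH']]].
have w0 : w != 0.
  apply/eqP => w0; case: PH PH' => p [_ +] [q [_]].
  by rewrite HE HE' /= w0 !(dotC _ 0) !dot0l; lra.
split.
- exists w, (1 - c); rewrite HE planeE; split=> //; last by rewrite -planeE -HE.
  by move=> x /P01; rewrite -/(dot _ _); lra.
- exists (- w), c; rewrite oppr_eq0; split=> //.
    rewrite HE'; apply/seteqP; split=> x; rewrite /plane /= -!/(dot _ _) dotNr; lra.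
  by move=> x /P01; rewrite -/(dot _ _) dotNr; lra.
(* Translation by this vector lowers the affine function by exactly 1. *)
- exists (- (dot w w)^-1 *: w).
  have ww : dot w w != 0 by rewrite dotxx_eq0.
  have vw : dot (- (dot w w)^-1 *: w) w = -1 by rewrite dotZl mulNr mulVf.
  rewrite HE HE' !aff_hull_id; try exact: affine_level.
  apply/seteqP; split=> [x /= xw|_ [x /= xw <-]].
    exists (x - - (dot w w)^-1 *: w); last by rewrite subrK.
    by rewrite /= dotBl vw; lra.
  by rewrite dotDl vw; lra.
- move=> HH; case: PH => p [_]; rewrite {1}HE => /= p1.
  have : H' p by rewrite -HH HE.
  by rewrite HE' /= p1; lra.
Qed.
End Hulls.

(** * Antipodality as separation by affine functions *)

Section Separation.
Variables (R : realType) (n : nat) (s : 'I_n -> set 'rV[R]_3).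
Local Notation E := 'rV[R]_3.
Implicit Types (i j k : 'I_n) (w x : E) (c : R).

Definition separates i j w c :=
  [/\ forall x, s i x -> dot x w + c = 1, forall x, s j x -> dot x w + c = 0
    & forall k x, s k x -> 0 <= dot x w + c <= 1].

Definition strictly_separates i j w c := separates i j w c /\
  forall k x, k != i -> k != j -> s k x -> 0 < dot x w + c < 1.

Lemma hull_of_union_sub k : s k `<=` hull_of_union s.
Proof. by move=> x sx; apply: sub_conv_hull; exists k. Qed.

Lemma hull_of_union_01 w c :
  (forall k x, s k x -> 0 <= dot x w + c <= 1) ->
  forall x, hull_of_union s x -> 0 <= dot x w + c <= 1.
Proof. by move=> H; apply: conv_hull_01 => x [k _]; exact: H. Qed.

Lemma antipodal_separates : antipodal s ->
  forall i j, i != j -> exists w c, separates i j w c.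
Proof.
move=> As i j ij; have [H [H' [/parallel_supportingP[w [c [HE HE' P01 _ _]]] [iH jH']]]] := As i j ij.
exists w, c; split=> [x /iH|x /jH'|k x sx]; rewrite ?HE ?HE' //.
by apply: P01; apply: hull_of_union_sub sx.
Qed.

Hypothesis s_neq0 : forall i, s i !=set0.

Lemma separates_antipodal :
  (forall i j, i != j -> exists w c, separates i j w c) -> antipodal s.
Proof.
move=> As i j ij; have [w [c [F1 F0 F01]]] := As i j ij.
exists [set x | dot x w + c = 1], [set x | dot x w + c = 0]; split; last by [].
apply/parallel_supportingP; exists w, c; split=> //.
- exact: hull_of_union_01.
- by have [x sx] := s_neq0 i; exists x; split; [apply: hull_of_union_sub sx|exact: F1].
- by have [x sx] := s_neq0 j; exists x; split; [apply: hull_of_union_sub sx|exact: F0].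
Qed.

(** A point of a third segment at level 1 or 0 would lie in the face [s i] or [s j], but members
    with different indices are disjoint because some function is 1 on one and 0 on the other. *)
Lemma strictly_antipodal_separates : strictly_antipodal s ->
  forall i j, i != j -> exists w c, strictly_separates i j w c.
Proof.
move=> Ss.
have As : antipodal s.
  move=> i j ij; have [H [H' [PH [iE jE]]]] := Ss i j ij.
  by exists H, H'; split=> //; rewrite iE jE; split=> x [].
have disj i j x : i != j -> s i x -> s j x -> False.
  move=> ij ix jx; have [w [c [F1 F0 _]]] := antipodal_separates As ij.
  by have := F1 _ ix; rewrite F0 // => /eqP; rewrite eq_sym oner_eq0.
move=> i j ij; have [H [H' [/parallel_supportingP[w [c [HE HE' P01 _ _]]] [iE jE]]]] := Ss i j ij.
have F01 k x : s k x -> 0 <= dot x w + c <= 1.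
  by move=> sx; apply: P01; apply: hull_of_union_sub sx.
exists w, c; split.
  by split=> // x; [rewrite iE HE => -[]|rewrite jE HE' => -[]].
move=> k x ki kj kx; have Px := hull_of_union_sub kx.
have /andP[F0 F1] := F01 _ _ kx; rewrite !lt_neqAle F0 F1 !andbT eq_sym.
apply/andP; split; apply/eqP => Fx.
  by apply: (disj k j x) => //; rewrite jE HE'.
by apply: (disj k i x) => //; rewrite iE HE.
Qed.

Lemma strictly_separates_antipodal : (forall i, convex_set (s i)) ->
  (forall i j, i != j -> exists w c, strictly_separates i j w c) ->
  strictly_antipodal s.
Proof.
move=> s_conv Ss i j ij; have [w [c [[F1 F0 F01] Fs]]] := Ss i j ij.
exists [set x | dot x w + c = 1], [set x | dot x w + c = 0]; split.
  apply/parallel_supportingP; exists w, c; split=> //.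
  - exact: hull_of_union_01.
  - by have [x sx] := s_neq0 i; exists x; split;
      [apply: hull_of_union_sub sx|exact: F1].
  - by have [x sx] := s_neq0 j; exists x; split;
      [apply: hull_of_union_sub sx|exact: F0].
split; apply/seteqP; split.
- by move=> x sx; split; [apply: hull_of_union_sub sx|exact: F1].
- apply: conv_hull_face => // x [k _ kx].
  have [<-|ki] := eqVneq k i; first by left.
  have [kj|kj] := eqVneq k j; first by right; rewrite F0 ?ltr01 -?kj.
  by right; have /andP[] := Fs k x ki kj kx.
- by move=> x sx; split; [apply: hull_of_union_sub sx|exact: F0].
(* The face at level 0 is the face at level 1 of the complementary function 1 - F. *)
- move=> x [Px /= Fx]; have G y : dot y (- w) + (1 - c) = 1 - (dot y w + c).
    by rewrite dotNr; ring.
  apply: (@conv_hull_face _ _ (\bigcup_k s k) (- w) (1 - c)) => //.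
  + by move=> y sy; rewrite G F0 // subr0.
  + move=> y [k _ ky].
    have [<-|kj] := eqVneq k j; first by left.
    right; rewrite G; have [ki|ki] := eqVneq k i.
      by rewrite F1 ?subrr ?ltr01 -?ki.
    by have /andP[] := Fs k y ki kj ky; lra.
  + by split=> //=; rewrite G Fx subr0.
Qed.

End Separation.

Lemma cvg_dot (R : realType) (x w : 'rV[R]_3) c :
  (fun y => dot y w + c) @ x --> dot x w + c.
Proof.
have -> : (fun y : 'rV[R]_3 => dot y w + c) =
    (fun y : 'rV[R]_3 => y 0 0 * w 0 0 + y 0 1 * w 0 1 + y 0 2 * w 0 2 + c).
  by apply/funext => y; rewrite dotE sum_ord3.
rewrite dotE sum_ord3.
have C i : (fun y : 'rV[R]_3 => y 0 i * w 0 i) @ nbhs x --> x 0 i * w 0 i.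
  by apply: (cvgMl (F := nbhs x)); exact: coord_continuous.
apply: (cvgD (F := nbhs x)); last exact: cvg_cst.
by apply: (cvgD (F := nbhs x)) (C _); apply: (cvgD (F := nbhs x)) (C _) (C _).
Qed.

(** * Parallelepipeds *)

Section Parallelepiped.
Variables (R : realType) (p : 'rV[R]_3) (V : 'M[R]_3).
Local Notation E := 'rV[R]_3.
Hypothesis V_free : row_free V.
Implicit Types (i j k l m : 'I_3) (e : 'I_3 -> bool) (x y u v w : E) (A Q : set E).

Definition box_coord k x : R := ((x - p) *m invmx V) 0 k.

Definition box : set E := [set x | forall k, 0 <= box_coord k x <= 1].

Definition box_edge k e : set E :=
  [set x | 0 <= box_coord k x <= 1 /\ forall l, l != k -> box_coord l x = (e l)%:R].

Lemma V_unit : V \in unitmx. Proof. by rewrite -row_free_unit. Qed.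

Lemma coordK (c : E) k : box_coord k (p + c *m V) = c 0 k.
Proof. by rewrite /box_coord addrC addKr mulmxK // V_unit. Qed.

Lemma coord_surj x : exists c : E, x = p + c *m V.
Proof. by exists ((x - p) *m invmx V); rewrite mulmxKV ?V_unit // addrC subrK. Qed.

Lemma boxP : is_parallelepiped box.
Proof.
exists p, V; split=> //; apply/seteqP; split=> [x xB|_ [c /= c01 <-] k].
  have [c xE] := coord_surj x; exists c => //= j.
  by have := xB j; rewrite xE coordK.
by rewrite coordK.
Qed.

Definition box_dual k : E := (col k (invmx V))^T.

Lemma coordE k x : box_coord k x = dot x (box_dual k) + - dot p (box_dual k).
Proof.
rewrite -dotBl /box_coord /dot trmxK !mxE.
by apply: eq_bigr => j _; rewrite !mxE.
Qed.

Lemma coord_comb k x y t :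
  box_coord k (x + t *: (y - x)) = box_coord k x + t * (box_coord k y - box_coord k x).
Proof. by rewrite !coordE dotDl dotZl dotBl; ring. Qed.

Lemma coord_inj x y : (forall k, box_coord k x = box_coord k y) -> x = y.
Proof.
have [c ->] := coord_surj x; have [c' ->] := coord_surj y => H.
by congr (_ + _ *m _); apply/rowP => k; have := H k; rewrite !coordK.
Qed.

Lemma dot_coord u : exists (mu : 'I_3 -> R) (c : R),
  (forall x, dot x u = c + \sum_k mu k * box_coord k x) /\
  ((forall k, mu k = 0) -> u = 0).
Proof.
exists (fun k => dot (row k V) u), (dot p u); split.
  move=> x; have [c ->] := coord_surj x; rewrite dotDl; congr (_ + _).
  rewrite {1}mulmx_sum_row /dot mulmx_suml summxE; apply: eq_bigr => k _.
  by rewrite coordK -scalemxAl mxE mulrC.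
move=> H; apply/eqP; apply: contraTT V_free => u0.
exact: orthogonal_dependent u0 H.
Qed.

Definition box_upd k t x : E := x + (t - box_coord k x) *: row k V.

Lemma coord_upd k t x l :
  box_coord l (box_upd k t x) = if l == k then t else box_coord l x.
Proof.
have [c ->] := coord_surj x; rewrite /box_upd -addrA rowE scalemxAl -mulmxDl !coordK.
by rewrite !mxE eqxx /=; case: eqP => [->|_] /=;
  rewrite ?mulr1 ?mulr0 ?addr0 // addrC subrK.
Qed.

Definition box_corner e : E := p + (\row_l (e l)%:R) *m V.

Lemma coord_corner e l : box_coord l (box_corner e) = (e l)%:R.
Proof. by rewrite coordK mxE. Qed.

Lemma box_edge_conv k e :
  box_edge k e = conv_hull [set box_upd k 0 (box_corner e); box_upd k 1 (box_corner e)].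
Proof.
rewrite conv_hull2; apply/seteqP; split=> [x [x01 xe]|_ [t /= t01 <-]].
  exists (box_coord k x) => //; apply: coord_inj => l.
  rewrite coord_comb !coord_upd coord_corner.
  by case: eqP => [->|/eqP lk]; [ring|rewrite (xe l lk); ring].
split=> [|l lk]; rewrite coord_comb !coord_upd ?coord_corner ?eqxx ?(negPf lk).
  by rewrite add0r subr0 mulr1.
by rewrite subrr mulr0 addr0.
Qed.

Lemma aff_hull_box_edge k e :
  aff_hull (box_edge k e) = [set x | forall l, l != k -> box_coord l x = (e l)%:R].
Proof.
rewrite box_edge_conv aff_conv_hull aff_hull2.
apply/seteqP; split=> [_ [t _ <-]|x xe] /=.
  move=> l lk; rewrite coord_comb !coord_upd coord_corner (negPf lk).
  by rewrite subrr mulr0 addr0.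
exists (box_coord k x) => //; apply: coord_inj => l.
rewrite coord_comb !coord_upd coord_corner.
by case: eqP => [->|/eqP lk]; [ring|rewrite (xe l lk); ring].
Qed.

Lemma box_edge_segment k e : is_segment (box_edge k e).
Proof.
exists (box_upd k 0 (box_corner e)), (box_upd k 1 (box_corner e)); split;
  last exact: box_edge_conv.
apply/eqP => /(congr1 (box_coord k)); rewrite !coord_upd eqxx => /eqP.
by rewrite eq_sym oner_eq0.
Qed.

Lemma box_edge_box k e : box_edge k e `<=` box.
Proof.
move=> x [x01 xe] l; have [->//|lk] := eqVneq l k.
by rewrite xe //; case: (e l); rewrite ?lexx ?ler01.
Qed.

Lemma box_edgeP k e : is_edge box (box_edge k e).
Proof.
split; last exact: box_edge_segment.
have [l [m [lk mk lm klm]]] := ord3_others k.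
(* [sg] orients the normals outwards, and [u] is the sum of the outward normals of the two facets
   that meet in the edge. *)
pose sg j : R := if e j then 1 else -1.
pose u := sg l *: box_dual l + sg m *: box_dual m.
pose c0 := sg l * dot p (box_dual l) + sg m * dot p (box_dual m).
have uE x : dot x u = sg l * box_coord l x + sg m * box_coord m x + c0.
  by rewrite dotDr !dotZr !coordE /c0; ring.
have sgE j : sg j * (e j)%:R = (e j)%:R by rewrite /sg; case: (e j);
  rewrite ?mulr1 ?mulr0.
have le_sg j (t : R) : 0 <= t <= 1 -> sg j * t <= (e j)%:R ?= iff (t == (e j)%:R).
  move=> /andP[t0 t1]; rewrite /sg; case: (e j) => /=; apply/leifP.
    by case: eqP => [->|/eqP t1']; rewrite mul1r // lt_neqAle t1' t1.
  by case: eqP => [->|/eqP t0'];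
    rewrite ?mulr0 // mulN1r oppr_lt0 lt_neqAle eq_sym t0' t0.
pose c := (e l)%:R + (e m)%:R + c0.
have edge_c x : box_edge k e x -> dot x u = c.
  by move=> [_ xe]; rewrite uE !xe // !sgE.
have in_edge : box_edge k e (box_upd k 0 (box_corner e)).
  rewrite box_edge_conv; apply: sub_conv_hull; by left.
exists (plane u c).
  exists u, c; split=> //.
  - apply/eqP => u0; have := uE (box_upd l 1 (box_upd m 0 p));
      have := uE (box_upd l 0 (box_upd m 0 p)).
    rewrite !u0 !(dotC _ 0) !dot0l !coord_upd eqxx eq_sym (negPf lm) eqxx /sg.
    by case: (e l); lra.
  - move=> x xB; rewrite -/(dot x u) uE /c lerD2r lerD //;
      first exact: (le_sg l _ (xB l)).1.
    exact: (le_sg m _ (xB m)).1.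
  - exists (box_upd k 0 (box_corner e)); split; last exact: edge_c.
    exact: box_edge_box in_edge.
apply/seteqP; split=> [x xe|x [xB]].
  by split; [exact: box_edge_box xe|exact: edge_c].
rewrite /plane /= -/(dot x u) uE /c => /addIr /eqP.
have [Ll El] := le_sg l _ (xB l); have [Lm Em] := le_sg m _ (xB m).
(* Two upper bounds whose sum is attained are both attained. *)
move=> H; have {H} : (sg l * box_coord l x == (e l)%:R) && (sg m * box_coord m x == (e m)%:R).
  rewrite !eq_le Ll Lm /=; move/eqP: H => H; apply/andP; split; lra.
rewrite El Em => /andP[/eqP xl /eqP xm]; split=> // j.
by have /or3P[/eqP->|/eqP->|/eqP->] := klm j; rewrite ?eqxx.
Qed.

(** On the face where [u] is maximal, a coordinate with nonzero coefficient [mu] is pinned to 0 or 1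
    and every other one is free. A segment has exactly one free coordinate. *)
Lemma edge_box_edge A : is_edge box A -> exists k e, A = box_edge k e.
Proof.
move=> [[H [u [c [u0 HE uB _]]] AE] [a [b [ab AC]]]].
have [mu [c0 [uE _]]] := dot_coord u.
have updE k t x : dot (box_upd k t x) u = dot x u + mu k * (t - box_coord k x).
  rewrite !uE -addrA; congr (_ + _).
  rewrite (bigD1 k) //= [in RHS](bigD1 k) //= coord_upd eqxx.
  rewrite (eq_bigr (fun i => mu i * box_coord i x)); first by ring.
  by move=> i /negPf ik; rewrite coord_upd ik.
have AP x : A x <-> box x /\ dot x u = c.
  by rewrite AE HE; split=> [[]|[]].
have updB k (t : R) x : 0 <= t <= 1 -> box x -> box (box_upd k t x).
  by move=> t01 xB l; rewrite coord_upd; case: ifP.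
have updle k (t : R) x : 0 <= t <= 1 -> A x -> mu k * (t - box_coord k x) <= 0.
  move=> t01 /AP[xB xc]; have := uB _ (updB k t x t01 xB).
  by rewrite -/(dot _ u) updE xc; lra.
have [z01 o01] : 0 <= (0 : R) <= 1 /\ 0 <= (1 : R) <= 1 by rewrite !lexx ler01.
have pos k x : 0 < mu k -> A x -> box_coord k x = 1.
  move=> mk Ax; have := updle k 1 x o01 Ax; have /AP[/(_ k) /andP[_ +] _] := Ax.
  by rewrite pmulr_rle0 //; lra.
have neg k x : mu k < 0 -> A x -> box_coord k x = 0.
  move=> mk Ax; have := updle k 0 x z01 Ax; have /AP[/(_ k) /andP[+ _] _] := Ax.
  by rewrite nmulr_rle0 //; lra.
have Aa : A a by rewrite AC; apply: sub_conv_hull; left.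
have Ab : A b by rewrite AC; apply: sub_conv_hull; right.
have [k kab] : exists k, box_coord k a != box_coord k b.
  apply/existsP; apply: contraNT ab; rewrite negb_exists => /forallP ab.
  by apply/eqP; apply: coord_inj => k; apply/eqP; rewrite -[_ == _]negbK.
have muk : mu k = 0.
  have [mk|mk|//] := ltgtP (mu k) 0.
    by move: kab; rewrite !(neg k) ?eqxx.
  by move: kab; rewrite !(pos k) ?eqxx.
(* If l were free too, moving [a] in this coordinate would stay in A. The points obtained agree in
   coordinate k, which parametrises the segment, yet differ in coordinate l. *)
have mul l : l != k -> mu l != 0.
  move=> lk; apply/eqP => ml0.
  have Aupd (t : R) : 0 <= t <= 1 -> A (box_upd l t a).
    move=> t01; apply/AP; have /AP[aB ac] := Aa.
    by split; [exact: updB|rewrite updE ml0 mul0r addr0].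
  have := Aupd _ z01; have := Aupd _ o01; rewrite AC conv_hull2.
  move=> [r _ rE] [t _ tE].
  have rt : r = t.
    have := congr1 (box_coord k) rE; have := congr1 (box_coord k) tE.
    rewrite !coord_comb !coord_upd eq_sym (negPf lk) => Et Er.
    apply: (@mulIf _ (box_coord k b - box_coord k a)); first by rewrite subr_eq0 eq_sym.
    by lra.
  have := congr1 (box_coord l) tE; have := congr1 (box_coord l) rE.
  by rewrite rt !coord_comb !coord_upd eqxx; lra.
have Ae x l : A x -> l != k -> box_coord l x = (0 < mu l)%R%:R.
  move=> Ax /mul; case: ltgtP => // ml _; first exact: pos.
  exact: neg.
exists k, (fun l => 0 < mu l); apply/seteqP; split=> [x Ax|x xe].
  split; last by move=> l; exact: Ae.
  by have /AP[] := Ax.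
apply/AP; split; first exact: box_edge_box xe.
have /AP[_ <-] := Aa; rewrite !uE; congr (_ + _); apply: eq_bigr => l _.
have [->|lk] := eqVneq l k; first by rewrite muk !mul0r.
by case: xe => _ -> //; rewrite Ae.
Qed.

Lemma parallel_box_edge k e l e' : parallel (box_edge k e) (box_edge l e') <-> k = l.
Proof.
split=> [[v vE]|<-].
  apply/eqP; apply: contraT => kl; move: vE; rewrite !aff_hull_box_edge => vE.
  have H t : box_coord k (box_upd k t (box_corner e) + v) = (e' k)%:R.
    have : [set x | forall m, m != l -> box_coord m x = (e' m)%:R]
        (box_upd k t (box_corner e) + v).
      rewrite vE; exists (box_upd k t (box_corner e)) => // m mk /=.
      by rewrite coord_upd (negPf mk) coord_corner.
    by apply.
  have C t : box_coord k (box_upd k t (box_corner e) + v) = t + dot v (box_dual k).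
    have := coord_upd k t (box_corner e) k; rewrite eqxx => {2}<-.
    by rewrite !coordE dotDl; ring.
  by have := H 0; have := H 1; rewrite !C; lra.
exists (box_corner e' - box_corner e); rewrite !aff_hull_box_edge.
have C m x : box_coord m (x + (box_corner e' - box_corner e)) =
  box_coord m x + (e' m)%:R - (e m)%:R.
  by rewrite -!coord_corner !coordE dotDl dotBl; ring.
apply/seteqP; split=> [x xe|_ [x xe <-] m mk]; last by rewrite C xe //; ring.
exists (x + (box_corner e - box_corner e')); last first.
  by rewrite -addrA addrACA -opprD [box_corner e' + _]addrC subrr addr0.
move=> m mk; have := C m (x + (box_corner e - box_corner e')).
have -> : x + (box_corner e - box_corner e') + (box_corner e' - box_corner e) = x.
  by rewrite -addrA addrACA -opprD [box_corner e' + _]addrC subrr addr0.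
by rewrite xe //; lra.
Qed.

Lemma skew_box_edge k e l e' : Defs.skew (box_edge k e) (box_edge l e') <->
  k != l /\ exists m, [/\ m != k, m != l & e m != e' m].
Proof.
split=> [[/parallel_box_edge /eqP kl dis]|[/eqP kl [m [mk ml ee']]]].
  split=> //; apply: contrapT => nex.
  (* If the coordinates in the third direction agree, the two lines meet at this corner. *)
  pose f m := if m == k then e' m else e m.
  suff : (aff_hull (box_edge k e) `&` aff_hull (box_edge l e')) (box_corner f) by rewrite dis.
  rewrite !aff_hull_box_edge; split=> m mk; rewrite coord_corner /f;
    first by rewrite (negPf mk).
  case: eqP => // /eqP mk'; congr (_%:R); congr nat_of_bool.
  by apply/eqP; apply: contra_notT nex => ee'; exists m.
split; first by move/parallel_box_edge.
apply/seteqP; split=> // x; rewrite !aff_hull_box_edge => -[/(_ m mk) xm /(_ m ml)].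
by move: ee'; rewrite xm; case: (e m); case: (e' m) => //= _ /eqP;
  rewrite ?oner_eq0 // eq_sym oner_eq0.
Qed.

Lemma box_opposite_planes (k : 'I_3) :
  parallel_supporting_planes box
    [set x | box_coord k x = 1] [set x | box_coord k x = 0].
Proof.
apply/parallel_supportingP; exists (box_dual k), (- dot p (box_dual k)); split.
- by apply/seteqP; split=> x /=; rewrite coordE.
- by apply/seteqP; split=> x /=; rewrite coordE.
- by move=> x /(_ k); rewrite coordE.
- exists (box_corner xpredT); split=> [l|] /=; rewrite coord_corner //=.
  by rewrite ler01 lexx.
- exists (box_corner xpred0); split=> [l|] /=; rewrite coord_corner //=.
  by rewrite ler01 lexx.
Qed.

Lemma coord_affine_comb k x y t :
  box_coord k ((1 - t) *: x + t *: y) = (1 - t) * box_coord k x + t * box_coord k y.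
Proof. by rewrite !coordE dot_aff. Qed.

Lemma aff_hull_box_slice k (t : bool) :
  aff_hull (box `&` [set x | box_coord k x = t%:R]) = [set x | box_coord k x = t%:R].
Proof.
apply/seteqP; split.
  apply: aff_hull_sub => [x y r /= xk yk|x []//].
  by rewrite coord_affine_comb xk yk; ring.
move=> x /= xk; set A := _ `&` _.
have [l [m [lk mk lm klm]]] := ord3_others k.
pose q (r1 r2 : R) := box_upd l r1 (box_upd m r2 x).
have qE r1 r2 : (box_coord k (q r1 r2) = t%:R) * (box_coord l (q r1 r2) = r1) *
    (box_coord m (q r1 r2) = r2).
  rewrite /q !coord_upd // !eqxx ![_ == l]eq_sym (negPf lk) [k == m]eq_sym (negPf mk).
  by rewrite (negPf lm) xk.
have qA (r1 r2 : bool) : A (q r1%:R r2%:R).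
  split; last by rewrite /= qE.
  have B (r : bool) : 0 <= (r%:R : R) <= 1 by case: r; rewrite ?lexx ?ler01.
  by move=> j; have /or3P[/eqP->|/eqP->|/eqP->] := klm j; rewrite qE.
(* x is the midpoint of the points with (l, m)-coordinates (2 x_l, 0) and (0, 2 x_m), each on a line
   through two vertices of the slice. *)
have -> : x = (1 - 2^-1) *: ((1 - 2 * box_coord l x) *: q 0 0 + (2 * box_coord l x) *: q 1 0)
    + 2^-1 *: ((1 - 2 * box_coord m x) *: q 0 0 + (2 * box_coord m x) *: q 0 1).
  apply: coord_inj => // j; rewrite !coord_affine_comb.
  by have /or3P[/eqP->|/eqP->|/eqP->] := klm j; rewrite !qE ?xk; field.
by do 2 apply: aff_hull_affine; apply: sub_aff_hull;
  [exact: (qA false false)|exact: (qA true false)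
  |exact: (qA false false)|exact: (qA false true)].
Qed.

Lemma box_facet k (t : bool) : is_facet box (box `&` [set x | box_coord k x = t%:R]).
Proof.
exists [set x | box_coord k x = t%:R]; last by rewrite aff_hull_box_slice.
by have [H1 H0 _ _] := box_opposite_planes k; case: t.
Qed.

Lemma box_edge_inj k (e e' : 'I_3 -> bool) :
  box_edge k e = box_edge k e' -> forall l, l != k -> e l = e' l.
Proof.
move=> ee' l lk.
have : box_edge k e (box_upd k 0 (box_corner e)).
  split=> [|m mk]; rewrite coord_upd //; first by rewrite eqxx lexx ler01.
  by rewrite (negPf mk) coord_corner.
rewrite ee' => -[_ /(_ l lk)]; rewrite coord_upd // (negPf lk) coord_corner //.
by case: (e l); case: (e' l) => //= /eqP; rewrite ?oner_eq0 // eq_sym oner_eq0.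
Qed.
Lemma relint_box_edge k e :
  relint (box_edge k e) = [set x | box_edge k e x /\ 0 < box_coord k x < 1].
Proof.
apply/seteqP; split=> x /= [xe].
  rewrite /within /= aff_hull_box_edge // => near_x; split=> //.
  have [/andP[x0 x1] xl] := xe; rewrite !lt_neqAle x0 x1 !andbT eq_sym.
  (* Varying coordinate k stays on the line of the edge. If x were an end point, points of the line
     arbitrarily close to it would have this coordinate outside [0, 1]. *)
  have cvg_upd : (fun t => box_upd k t x) @ (box_coord k x) --> x.
    have -> : (fun t => box_upd k t x) =
      (fun t => x + (t - box_coord k x) *: row k V) by [].
    rewrite -[X in _ --> X]addr0 -[X in _ + X](scale0r (row k V)) -(subrr (box_coord k x)).
    apply: cvgD; first exact: cvg_cst.
    apply: cvgZl; apply: cvgB; [exact: cvg_id|exact: cvg_cst].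
  have upd_aff t : forall l, l != k -> box_coord l (box_upd k t x) = (e l)%:R.
    by move=> l lk; rewrite coord_upd // (negPf lk) xl.
  have near_t : \forall t \near box_coord k x, box_edge k e (box_upd k t x).
    move: (cvg_upd _ near_x); apply: (@filterS _ (nbhs (box_coord k x))) => t; apply.
    exact: upd_aff.
  apply/andP; split; apply/eqP => xk.
    have : \forall t \near (box_coord k x)^'-, box_edge k e (box_upd k t x).
      exact: cvg_within.
    move=> near_l; near (box_coord k x)^'- => t.
    have tx : t < box_coord k x by near: t; exact: nbhs_left_lt.
    have : box_edge k e (box_upd k t x) by near: t.
    by case=> + _; rewrite coord_upd // eqxx; rewrite xk in tx; lra.
  have : \forall t \near (box_coord k x)^'+, box_edge k e (box_upd k t x).
    exact: cvg_within.
  move=> near_r; near (box_coord k x)^'+ => t.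
  have tx : box_coord k x < t by near: t; exact: nbhs_right_gt.
  have : box_edge k e (box_upd k t x) by near: t.
  by case=> + _; rewrite coord_upd // eqxx; rewrite xk in tx; lra.
move=> /andP[x0 x1]; split=> //; rewrite /within /= aff_hull_box_edge //.
have coord_cvg : box_coord k @ x --> box_coord k x.
  by rewrite coordE
    (_ : box_coord k = fun y => dot y (box_dual k) + - dot p (box_dual k));
    [exact: cvg_dot|apply/funext => y; exact: coordE].
near=> y => ye; split=> //; apply/andP; split; apply: ltW; near: y.
  exact: (cvgr_gt _ coord_cvg).
exact: (cvgr_lt _ coord_cvg).
Unshelve. all: by end_near.
Qed.

End Parallelepiped.


(** * Assigning segments to edges, and boxes with prescribed coordinates *)

Lemma one_in_eachI (R : realType) n m
    (s : 'I_n -> set 'rV[R]_3) (e : 'I_m -> set 'rV[R]_3)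
    (g : 'I_m -> 'I_n) : n = m -> injective g -> (forall k, s (g k) `<=` e k) ->
  one_in_each s e.
Proof.
move=> nm; subst m => g_inj ge; exists (invF g_inj); split.
  by exists g; [exact: f_invF|exact: invF_f].
by move=> i; rewrite -{1}(f_invF g_inj i); exact: ge.
Qed.

Lemma one_in_each_card (R : realType) n m (s : 'I_n -> set 'rV[R]_3)
  (e : 'I_m -> set 'rV[R]_3) : one_in_each s e -> n = m.
Proof. by move=> [f [/bij_eq_card + _]]; rewrite !card_ord. Qed.

(** Separating functions become the coordinates of a parallelepiped: its edge vectors are the basis
    dual to [w], and its vertex is the common zero of the three functions. *)
Lemma box_of_functionals (R : realType) (w : 'I_3 -> 'rV[R]_3) (c : 'I_3 -> R) :
  row_free (rows3 (w 0) (w 1) (w 2)) ->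
  exists p V, row_free V /\ forall k x, box_coord p V k x = dot x (w k) + c k.
Proof.
move=> W_free; set W := rows3 _ _ _ in W_free.
have WT : W^T \in unitmx by rewrite unitmx_tr -row_free_unit.
exists (- ((\row_k c k) *m invmx W^T)), (invmx W^T); split.
  by rewrite row_free_unit unitmx_inv.
move=> k x; rewrite /box_coord invmxK opprK mulmxDl mulmxKV // !mxE; congr (_ + _).
rewrite /dot mxE; apply: eq_bigr => j _; rewrite !mxE; congr (_ * _).
by move: k; apply: ord3P.
Qed.

Lemma nth_ord_inj (T : eqType) (x0 : T) (s : seq T) m :
  uniq s -> size s = m -> injective (fun k : 'I_m => nth x0 s k).
Proof.
by move=> us sm k l /eqP; rewrite nth_uniq ?sm // => /eqP/val_inj.
Qed.


(** * Extremal configurations *)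

Section Forward.
Variables (R : realType) (n : nat) (s : 'I_n -> set 'rV[R]_3).
Local Notation E := 'rV[R]_3.
Variables (a b : 'I_n -> E) (w : 'I_n -> 'I_n -> E) (c : 'I_n -> 'I_n -> R).
Local Notation d i := (b i - a i).
Local Notation F i j x := (dot x (w i j) + c i j).
Local Notation npar i j := (~ par (d i) (d j)).
Hypothesis sE : forall i, s i = conv_hull [set a i; b i].
Hypothesis d_neq0 : forall i, d i != 0.
Hypothesis sep : forall i j, i != j -> separates s i j (w i j) (c i j).
Implicit Types (i j k l : 'I_n) (x : E).

Lemma s_a i : s i (a i). Proof. by rewrite sE; apply: sub_conv_hull; left. Qed.
Lemma s_b i : s i (b i). Proof. by rewrite sE; apply: sub_conv_hull; right. Qed.

Lemma F_top i j : i != j -> F i j (a i) = 1 /\ F i j (b i) = 1.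
Proof. by move=> /sep[H _ _]; split; apply: H; [exact: s_a|exact: s_b]. Qed.

Lemma F_bot i j : i != j -> F i j (a j) = 0 /\ F i j (b j) = 0.
Proof. by move=> /sep[_ H _]; split; apply: H; [exact: s_a|exact: s_b]. Qed.

Lemma F_01 i j k : i != j -> 0 <= F i j (a k) <= 1 /\ 0 <= F i j (b k) <= 1.
Proof. by move=> /sep[_ _ H]; split; apply: (H k); [exact: s_a|exact: s_b]. Qed.

Lemma s_dir i x : s i x -> exists2 t, 0 <= t <= 1 & x = a i + t *: d i.
Proof. by rewrite sE conv_hull2 => -[t t01 <-]; exists t. Qed.

(** Along the common direction the four lines project to a parallelogram with k opposite to l. A
    sufficiently long prism over it is the parallelepiped. *)
Lemma parallelogram_edges i j k l (de : R) :
  n = 4 -> uniq [:: i; j; k; l] ->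
  par (d k) (d i) -> par (d k) (d j) -> par (d k) (d l) ->
  a l = a i + a j - a k + de *: d k -> on_four_parallel_edges s.
Proof.
move=> n4 us [mi diE] [mj djE] [ml dlE] alE.
have [ki ij jk] : [/\ k != i, i != j & j != k].
  by move: us; rewrite /= !inE !negb_or => /and4P[/and3P[? ? ?] /andP[? ?] ? _];
    rewrite eq_sym.
have U := par_free d_neq0 F_top F_bot F_01 ki ij jk (ex_intro _ _ diE) (ex_intro _ _ djE).
(* [M] bounds the parameters along [d k], measured from the corners of the parallelogram, of all
   points of the segments; the summand 1 serves [s k]. The edges then run from - M to M. *)
pose M := 1 + `|de| + `|mi| + `|mj| + `|ml|.
have M0 : 0 < M by rewrite /M !ltr_wpDr.
have M2 : 2 * M != 0 by rewrite mulf_neq0 // gt_eqF.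
pose p := a k - M *: d k.
pose V := rows3 (a i - a k) (a j - a k) ((2 * M) *: d k).
have V_free : row_free V.
  apply: rows3_free => al be ga; rewrite scalerA => E0.
  move: U; rewrite row_free_unit => U.
  pose r : 'rV_3 := \row_m nth 0 [:: al; be; ga * (2 * M)] m.
  have r0 : r = 0.
    apply: (can_inj (mulmxK U)); rewrite mul0mx mul_rows3 !mxE /=.
    exact: E0.
  have r0m m : r 0 m = 0 by rewrite r0 mxE.
  have := r0m 0; have := r0m 1; have := r0m 2; rewrite !mxE /= => /eqP.
  by rewrite mulf_eq0 (negPf M2) orbF => /eqP.
have coordP x al be ta : x = a k + al *: (a i - a k) + be *: (a j - a k) + ta *: d k ->
    [/\ box_coord p V 0 x = al, box_coord p V 1 x = be
      & box_coord p V 2 x = (ta + M) / (2 * M)].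
  move=> xE; have -> : x =
      p + (\row_(m < 3) nth 0 [:: al; be; (ta + M) / (2 * M)] m) *m V.
    rewrite mul_rows3 !mxE /= scalerA divfK // xE /p.
    by apply/rowP => m; rewrite !mxE; ring.
  by rewrite !coordK // !mxE.
(* (b0, b1) are the coordinates of the corners i, j, k, l in this order. *)
pose b0 (m : 'I_4) := nth false [:: true; false; false; true] m.
pose b1 (m : 'I_4) := nth false [:: false; true; false; true] m.
pose e (m : 'I_4) := box_edge p V 2 (fun q => if q == 0 then b0 m else b1 m).
exists (box p V), e; split.
- exact: boxP.
- move=> q r /(box_edge_inj V_free) H; have := H 0 isT; have := H 1 isT;
    rewrite /b0 /b1 /=.
  by move: q r {H} => [[|[|[|[|//]]]] ?] [[|[|[|[|//]]]] ?] //= _ _; apply: val_inj.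
- by move=> q; exact: box_edgeP.
- by move=> q r; apply/parallel_box_edge.
have edgeI (m : 'I_4) x (ta : R) : `|ta| <= M ->
    x = a k + (b0 m)%:R *: (a i - a k) + (b1 m)%:R *: (a j - a k) + ta *: d k -> e m x.
  move=> taM /coordP[x0 x1 x2]; split; last by apply: ord3P; rewrite ?x0 ?x1.
  move: taM; rewrite ler_norml => /andP[t1 t2]; rewrite x2.
  by rewrite ler_pdivlMr ?ler_pdivrMr ?mulr_gt0 //; lra.
apply: (one_in_eachI (g := fun m => nth i [:: i; j; k; l] m)) => //.
  exact: nth_ord_inj.
have n1 := normr_ge0 de; have n2 := normr_ge0 mi.
have n3 := normr_ge0 mj; have n5 := normr_ge0 ml.
have bd (t r : R) : 0 <= t <= 1 -> `|t * r| <= `|r|.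
  by move=> /andP[u0 u1]; rewrite normrM ger0_norm // ler_piMl.
move=> [[|[|[|[|//]]]] lm] x /= /s_dir[t t01 xE].
- apply: (edgeI _ _ (t * mi)); first by rewrite (le_trans (bd _ _ t01)) // /M; lra.
  by rewrite xE diE /=; apply/rowP => q; rewrite !mxE; ring.
- apply: (edgeI _ _ (t * mj)); first by rewrite (le_trans (bd _ _ t01)) // /M; lra.
  by rewrite xE djE /=; apply/rowP => q; rewrite !mxE; ring.
- apply: (edgeI _ _ t).
    by move: t01 => /andP[t0 t1]; rewrite ger0_norm // /M; lra.
  by rewrite xE /=; apply/rowP => q; rewrite !mxE; ring.
- apply: (edgeI _ _ (de + t * ml)).
    by rewrite (le_trans (ler_normD _ _)) //; have := bd _ ml t01; rewrite /M; lra.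
  by rewrite xE dlE alE /=; apply/rowP => q; rewrite !mxE; ring.
Qed.

Lemma uniq4P i j k l : uniq [:: i; j; k; l] ->
  [/\ i != j, i != k, i != l & [/\ j != k, j != l & k != l]].
Proof.
by rewrite /= !inE !negb_or => /and4P[/and3P[? ? ?] /andP[? ?] ? _].
Qed.

Lemma par_four_edges i j k l : n = 4 -> uniq [:: i; j; k; l] ->
  par (d i) (d j) -> par (d i) (d k) -> par (d i) (d l) ->
  on_four_parallel_edges s.
Proof.
move=> n4 us Pij Pik Pil; have [ij ik il [jk jl kl]] := uniq4P us.
have ki : k != i by rewrite eq_sym.
have kj : k != j by rewrite eq_sym.
have [de H] := par_parallelogram d_neq0 F_top F_bot F_01 ij jk ki il jl kl Pij Pik Pil.
have parT p q : par (d i) (d p) -> par (d i) (d q) -> par (d p) (d q).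
  by move=> /(par_sym (d_neq0 p)) P; exact: par_trans P.
have di p : par (d i) (d p) -> exists r, de *: d i = r *: d p.
  move=> /(par_sym (d_neq0 p))[t tE]; exists (de * t); by rewrite [in LHS]tE scalerA.
have Pii := par_refl (d i).
(* The vertex opposite to l is k, j or i; the offset is rewritten along the direction of that
   segment. *)
case: H => lE.
- have [r rE] := di k Pik; rewrite rE in lE.
  by apply: (parallelogram_edges n4 us _ _ _ lE); exact: parT.
- have [r rE] := di j Pij; rewrite rE in lE.
  apply: (parallelogram_edges n4 _ _ _ _ lE); try exact: parT.
  by rewrite /= !inE !negb_or ij ik il kj kl jl.
- have [r rE] := di i Pii; rewrite rE in lE.
  apply: (parallelogram_edges n4 _ _ _ _ lE); try exact: parT.
  by rewrite /= !inE !negb_or [j == i]eq_sym ij ki kl jk jl il.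
Qed.

(** The box coordinates are F_jl, F_ik and F_ij. The last is 1 on i and k and 0 on j and l, which
    gives the opposite facets; the other two separate the members of each parallel pair. *)
Lemma par_opposite_faces i j k l : n = 4 -> uniq [:: i; j; k; l] ->
  npar i j -> par (d i) (d k) -> par (d j) (d l) ->
  on_parallel_edges_of_opposite_faces s.
Proof.
move=> n4 us Pij Pik Pjl; have [ij ik il [jk jl kl]] := uniq4P us.
have [Sik1 Sik0 Sik] := sep ik; have [Sjl1 Sjl0 Sjl] := sep jl.
have [Sij1 Sij0 Sij] := sep ij.
have wii := w_top F_top ij; have wjj := w_bot F_bot ij.
have wik := w_top F_top ik; have wjl := w_top F_top jl.
(* Otherwise the normals of F_pr and F_pq would be proportional, but F_pq takes the value 1 at both
   p and r while F_pr distinguishes them. *)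
have on_level p q r : npar p q -> par (d p) (d r) -> p != r ->
    dot (d q) (w p r) != 0.
  move=> Ppq Ppr pr; have pq := npar_neq Ppq; apply/eqP => w0.
  have [t tE] := normal_unique (d_neq0 p) Ppq (w_neq0 F_top F_bot pq)
    (w_top F_top pq) (w_bot F_bot pq) (w_top F_top pr) w0.
  have [T1 _] := F_top pr; have [B1 _] := F_bot pr.
  have [T2 _] := F_top pq; have := F_class_top d_neq0 F_top F_bot F_01 Ppq Ppr.
  move: T1 B1; rewrite tE !dotZr => T1 B1 C.
  have E1 : dot (a r) (w p q) = dot (a p) (w p q) by lra.
  by move: B1; rewrite E1; lra.
have wij_ik := on_level _ _ _ Pij Pik ik.
have wji_jl := on_level _ _ _ (npar_sym d_neq0 Pij) Pjl jl.
have W_free : row_free (rows3 (w j l) (w i k) (w i j)).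
  apply: rows3_free => al be ga E0.
  have al0 : al = 0.
    have := congr1 (dot (d i)) E0.
    rewrite !dotDr !dotZr wii wik (dotC _ 0) dot0l !mulr0 !addr0 => /eqP.
    by rewrite mulf_eq0 (negPf wji_jl) orbF => /eqP.
  have be0 : be = 0.
    have := congr1 (dot (d j)) E0.
    rewrite !dotDr !dotZr wjj wjl (dotC _ 0) dot0l !mulr0 !addr0 add0r => /eqP.
    by rewrite mulf_eq0 (negPf wij_ik) orbF => /eqP.
  move: E0; rewrite al0 be0 !scale0r !add0r => /eqP.
  by rewrite scaler_eq0 (negPf (w_neq0 F_top F_bot ij)) orbF => /eqP.
pose cc (m : 'I_3) : R := nth 0 [:: c j l; c i k; c i j] m.
pose ww (m : 'I_3) : E := nth 0 [:: w j l; w i k; w i j] m.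
have [p [V [V_free coordE]]] := @box_of_functionals _ ww cc W_free.
have in_box q x : s q x -> box p V x.
  by move=> sx; apply: ord3P; rewrite coordE;
    [exact: Sjl sx|exact: Sik sx|exact: Sij sx].
have Fk x : s k x -> F i j x = 1.
  move=> /s_dir[t _ ->]; rewrite dotDl dotZl (par_dot Pik wii) mulr0 addr0.
  exact: (F_class_top d_neq0 F_top F_bot F_01 Pij Pik).
have Fl x : s l x -> F i j x = 0.
  move=> /s_dir[t _ ->]; rewrite dotDl dotZl (par_dot Pjl wjj) mulr0 addr0.
  exact: (F_class_bot d_neq0 F_top F_bot F_01 Pij Pjl).
pose ei := box_edge p V 0 xpredT.
pose ek := box_edge p V 0 (fun q => q == 2).
pose ej := box_edge p V 1 (fun q => q == 0).
pose el := box_edge p V 1 xpred0.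
pose top := box p V `&` [set x | box_coord p V 2 x = true%:R].
pose bot := box p V `&` [set x | box_coord p V 2 x = false%:R].
exists (box p V), top, bot, ei, ek, ej, el.
have [_ _ par01 neq01] := @box_opposite_planes _ p V V_free 2.
have neq_edge m e e' q : q != m -> e q != e' q ->
    box_edge p V m e <> box_edge p V m e'.
  by move=> qm /eqP ee' /(box_edge_inj V_free) /(_ _ qm).
have edge_slice m e (t : bool) : 2 != m -> e 2 = t ->
    box_edge p V m e `<=` box p V `&` [set x | box_coord p V 2 x = t%:R].
  by move=> m2 et x xe; split; [exact: box_edge_box xe|rewrite /= xe.2 // et].
split.
- exact: boxP.
- split; [exact: box_facet|exact: box_facet| |].
    have [v vE] := par01; exists v; rewrite !aff_hull_box_slice //.
    have aE t : aff_hull [set x | box_coord p V 2 x = t] =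
      [set x | box_coord p V 2 x = t].
      apply: aff_hull_id => x y r /= xt yt; rewrite coord_affine_comb xt yt; ring.
    by move: vE; rewrite !aE.
  move=> tb; apply: neq01; have := congr1 (@aff_hull R) tb.
  by rewrite !aff_hull_box_slice.
- split; [exact: box_edgeP|exact: box_edgeP|exact: edge_slice|exact: edge_slice|].
  exact: (neq_edge _ _ _ 1).
- split; [exact: box_edgeP|exact: box_edgeP|exact: edge_slice|exact: edge_slice|].
  exact: (neq_edge _ _ _ 0).
split; [exact/parallel_box_edge|exact/parallel_box_edge|
  by move/(@parallel_box_edge R p V V_free)/eqP|].
apply: (one_in_eachI (g := fun m => nth i [:: i; k; j; l] m)) => //.
  apply: nth_ord_inj => //; rewrite /= !inE !negb_or ij ik il jl kl.
  by rewrite [k == j]eq_sym jk.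
move=> [[|[|[|[|//]]]] lm] x /= sx; rewrite (tnth_nth set0) /=.
all: split; [exact: in_box sx _|apply: ord3P => //; rewrite coordE /= => _].
- exact: Sik1.
- exact: Sij1.
- exact: Sik0.
- exact: Fk.
- exact: Sjl1.
- exact: Sij0.
- exact: Sjl0.
- exact: Fl.
Qed.

Lemma antipodal4_configurations i j k l : n = 4 -> uniq [:: i; j; k; l] ->
  on_four_parallel_edges s \/ on_parallel_edges_of_opposite_faces s.
Proof.
move=> n4 us; have [ij ik il [jk jl kl]] := uniq4P us.
have N p q r t : uniq [:: p; q; r; t] -> npar p q ->
    on_parallel_edges_of_opposite_faces s.
  move=> us' Ppq; have [pq pr pt [qr qt rt]] := uniq4P us'.
  have [[H1 H2]|[H1 H2]] := npar_2_2 d_neq0 F_top F_bot F_01 Ppq pr qr pt qt rt.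
    exact: par_opposite_faces us' Ppq H1 H2.
  apply: par_opposite_faces Ppq H1 H2 => //.
  by rewrite /= !inE !negb_or pq pr pt qr qt eq_sym rt.
have [Pij|Pij] := EM (par (d i) (d j)); last by right; exact: N us Pij.
have [Pik|Pik] := EM (par (d i) (d k)); last first.
  by right; apply: (N i k j l) => //; rewrite /= !inE !negb_or ij ik il jl kl eq_sym jk.
have [Pil|Pil] := EM (par (d i) (d l)); last first.
  right; apply: (N i l j k) => //; rewrite /= !inE !negb_or ij ik il jk.
  by rewrite !(eq_sym l) jl kl.
by left; exact: par_four_edges us Pij Pik Pil.
Qed.

(** * Strictly antipodal configurations *)

Hypothesis strict : forall i j k x, i != j -> k != i -> k != j -> s k x ->
  0 < F i j x < 1.

Lemma strict_class i j k : npar i j -> i != k -> par (d i) (d k) -> False.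
Proof.
move=> Pij ik Pik; have ij := npar_neq Pij.
have kj : k != j.
  by apply: contra_not_neq Pij => <-.
have ki : k != i by rewrite eq_sym.
have /andP[_] := strict ij ki kj (s_a k).
by rewrite (F_class_top d_neq0 F_top F_bot F_01 Pij Pik) ltxx.
Qed.

Lemma strictly_antipodal_le3 i j k l : uniq [:: i; j; k; l] -> False.
Proof.
move=> us; have [ij ik il [jk jl kl]] := uniq4P us.
have [ji ki kj] : [/\ j != i, k != i & k != j] by split; rewrite eq_sym.
have N p q r t : uniq [:: p; q; r; t] -> npar p q -> False.
  move=> us' Ppq; have [pq pr pt [qr qt rt]] := uniq4P us'.
  by have [[H1 _]|[H1 _]] := npar_2_2 d_neq0 F_top F_bot F_01 Ppq pr qr pt qt rt;
    [apply: strict_class Ppq pr H1|apply: strict_class Ppq pt H1].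
have [Pij|Pij] := EM (par (d i) (d j)); last exact: N us Pij.
have [Pik|Pik] := EM (par (d i) (d k)); last first.
  by apply: (N i k j l) => //; rewrite /= !inE !negb_or ij ik il jl kl eq_sym jk.
have [Pil|Pil] := EM (par (d i) (d l)); last first.
  apply: (N i l j k) => //; rewrite /= !inE !negb_or ij ik il jk.
  by rewrite !(eq_sym l) jl kl.
have dw p q : p != q -> par (d i) (d p) -> dot (d i) (w p q) = 0.
  by move=> pq Pip; apply: par_dot (w_top F_top pq); apply: par_sym.
(* In a parallelogram with l opposite to k, F_ik is 1 + F_ik(a_j) at [a l], which exceeds 1 by
   strictness; the other two cases are alike. *)
have [de []] := par_parallelogram d_neq0 F_top F_bot F_01 ij jk ki il jl kl Pij Pik Pil.
- move=> lE; have := F_01 l ik; rewrite lE !dotDl dotNl dotZl (dw i k) //;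
    last exact: par_refl.
  have := F_top ik; have := F_bot ik; have := strict ik ji jk (s_a j); lra.
- move=> lE; have := F_01 l ij; rewrite lE !dotDl dotNl dotZl (dw i j) //;
    last exact: par_refl.
  have := F_top ij; have := F_bot ij; have := strict ij ki kj (s_a k); lra.
- move=> lE; have := F_01 l ji; rewrite lE !dotDl dotNl dotZl (dw j i) //.
  have := F_top ji; have := F_bot ji; have := strict ji kj ki (s_a k); lra.
Qed.

Lemma par_prism i j k : n = 3 -> aff_hull (\bigcup_i s i) = setT ->
  uniq [:: i; j; k] -> par (d i) (d j) -> par (d i) (d k) ->
  on_lateral_edges_of_triangular_prism s.
Proof.
move=> n3 s_span us [mj djE] [mk dkE].
(* Again [M] bounds all parameters along [d i], so that lateral edges from - M to M contain the
   segments. *)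
pose M := 1 + `|mj| + `|mk|.
have M0 : 0 < M by rewrite /M !ltr_wpDr.
have M2 : 2 * M != 0 by rewrite mulf_neq0 // gt_eqF.
pose g (q : 'I_3) := nth i [:: i; j; k] q.
pose t q := a (g q) - M *: d i; pose u := (2 * M) *: d i.
have one : one_in_each s (fun q => conv_hull [set t q; t q + u]).
  apply: (one_in_eachI (g := g)) => //; first exact: nth_ord_inj.
  have H q x ta : `|ta| <= M -> x = a (g q) + ta *: d i ->
      conv_hull [set t q; t q + u] x.
    move=> taM xE; rewrite conv_hull2; exists ((ta + M) / (2 * M)).
      move: taM; rewrite ler_norml => /andP[t1 t2] /=.
      by rewrite ler_pdivlMr ?ler_pdivrMr ?mulr_gt0 //; lra.
    rewrite [t q + u]addrC addrK /u scalerA divfK // xE /t.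
    by apply/rowP => r; rewrite !mxE; ring.
  have n1 := normr_ge0 mj; have n2 := normr_ge0 mk.
  have bd (r r' : R) : 0 <= r <= 1 -> `|r * r'| <= `|r'|.
    by move=> /andP[u0 u1]; rewrite normrM ger0_norm // ler_piMl.
  move=> [[|[|[|//]]] lq] x /= /s_dir[r r01 xE]; rewrite xE.
  - apply: (H (Ordinal lq) _ r) => //.
    by move: r01 => /andP[r0 r1]; rewrite ger0_norm // /M; lra.
  - apply: (H (Ordinal lq) _ (r * mj)); last by rewrite djE scalerA.
    by rewrite (le_trans (bd _ _ r01)) // /M; lra.
  - apply: (H (Ordinal lq) _ (r * mk)); last by rewrite dkE scalerA.
    by rewrite (le_trans (bd _ _ r01)) // /M; lra.
(* The prism contains the segments, which already span the space. *)
exists t, u; split=> //; apply/seteqP; split=> // x _.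
have : aff_hull (\bigcup_i s i) x by rewrite s_span.
apply: aff_hull_sub => [|y [q _ qy]]; first exact: aff_hull_affine.
apply: sub_aff_hull; have [f [_ sf]] := one.
apply: conv_hull_min (sf _ _ qy) => z zt; apply: sub_conv_hull.
by case: zt => ->; [left; exists (f q)|right; exists (f q)].
Qed.

Lemma npar_skew_edges i j k : n = 3 -> uniq [:: i; j; k] ->
  npar i j -> npar j k -> npar k i -> inside_three_skew_edges s.
Proof.
move=> n3 us Pij Pjk Pki.
have ij := npar_neq Pij; have jk := npar_neq Pjk; have ki := npar_neq Pki.
have [ji kj ik] : [/\ j != i, k != j & i != k] by split; rewrite eq_sym.
have [Sij1 Sij0 Sij] := sep ij; have [Sjk1 Sjk0 Sjk] := sep jk.
have [Ski1 Ski0 Ski] := sep ki.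
have N := npar_not_coplanar d_neq0 F_top F_bot F_01.
have W_free : row_free (rows3 (w j k) (w k i) (w i j)).
  apply: rows3_free => al be ga E0; split.
  - have := congr1 (dot (d i)) E0.
    rewrite !dotDr !dotZr (w_top F_top ij) (w_bot F_bot ki) (dotC _ 0) dot0l.
    by rewrite !mulr0 !addr0 => /eqP;
      rewrite mulf_eq0 (negPf (N _ _ _ Pjk Pki Pij)) orbF => /eqP.
  - have := congr1 (dot (d j)) E0.
    rewrite !dotDr !dotZr (w_top F_top jk) (w_bot F_bot ij) (dotC _ 0) dot0l.
    by rewrite !mulr0 !addr0 add0r => /eqP;
      rewrite mulf_eq0 (negPf (N _ _ _ Pki Pij Pjk)) orbF => /eqP.
  - have := congr1 (dot (d k)) E0.
    rewrite !dotDr !dotZr (w_top F_top ki) (w_bot F_bot jk) (dotC _ 0) dot0l.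
    by rewrite !mulr0 !add0r => /eqP;
      rewrite mulf_eq0 (negPf (N _ _ _ Pij Pjk Pki)) orbF => /eqP.
pose cc (m : 'I_3) : R := nth 0 [:: c j k; c k i; c i j] m.
pose ww (m : 'I_3) : E := nth 0 [:: w j k; w k i; w i j] m.
have [p [V [V_free coordE]]] := @box_of_functionals _ ww cc W_free.
(* Addition is modulo 3: the edge in direction q has coordinate q - 1 equal to 1 and coordinate q +
   1 equal to 0, as F_ij is 1 and F_ki is 0 on the segment i. *)
pose e (q : 'I_3) := box_edge p V q (fun r => r + 1 == q).
exists (box p V), e; split.
- exact: boxP.
- by move=> q; exact: box_edgeP.
- move=> q r qr; apply/skew_box_edge => //; split=> //.
  by move: q r qr; do 2 apply: ord3P; move=> // _;
    first [by exists 0; split|by exists 1; split|by exists 2; split].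
apply: (one_in_eachI (g := fun q => nth i [:: i; j; k] q)) => //.
  exact: nth_ord_inj.
move=> q x sx; rewrite relint_box_edge //; move: q sx.
apply: ord3P => /= sx; (split; [split; [rewrite coordE|apply: ord3P => //;
  rewrite coordE /= => _]|rewrite coordE]).
- exact: Sjk sx.
- exact: Ski0.
- exact: Sij1.
- exact: strict sx.
- exact: Ski sx.
- exact: Sjk1.
- exact: Sij0.
- exact: strict sx.
- exact: Sij sx.
- exact: Sjk0.
- exact: Ski1.
- exact: strict sx.
Qed.

Lemma strictly_antipodal3_configurations i j k : n = 3 ->
  aff_hull (\bigcup_i s i) = setT -> uniq [:: i; j; k] ->
  on_lateral_edges_of_triangular_prism s \/ inside_three_skew_edges s.
Proof.
move=> n3 s_span us.
have N p q r : uniq [:: p; q; r] -> npar p q -> inside_three_skew_edges s.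
  move=> us'; move: (us'); rewrite /= !inE !negb_or andbT => /andP[/andP[pq pr] qr] Ppq.
  apply: (npar_skew_edges n3 us' Ppq) => P.
    exact: (strict_class (npar_sym d_neq0 Ppq) qr P).
  by apply: (strict_class Ppq pr); apply: par_sym.
have [Pij|Pij] := EM (par (d i) (d j)); last by right; exact: N us Pij.
have [Pik|Pik] := EM (par (d i) (d k)); first by left; exact: par_prism us Pij Pik.
right; apply: (N i k j _ Pik); move: us; rewrite /= !inE !negb_or !andbT.
by move=> /andP[/andP[-> ->]]; rewrite eq_sym => ->.
Qed.

End Forward.

(** * The listed configurations are antipodal *)

Section Converse.
Variables (R : realType) (n : nat) (s : 'I_n -> set 'rV[R]_3).
Local Notation E := 'rV[R]_3.
Hypothesis s_neq0 : forall i, s i !=set0.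
Implicit Types (A B Q : set E) (x w u : E) (c : R).

(** Separation relative to a containing body [Q], a form that passes to subsets of [A] and [B]. *)
Definition slab Q A B := exists w c,
  [/\ forall x, A x -> dot x w + c = 1, forall x, B x -> dot x w + c = 0
    & forall x, Q x -> 0 <= dot x w + c <= 1].

Lemma slab_sym Q A B : slab Q A B -> slab Q B A.
Proof.
move=> [w [c [A1 B0 Q01]]]; exists (- w), (1 - c).
have G x : dot x (- w) + (1 - c) = 1 - (dot x w + c) by rewrite dotNr; ring.
split=> x; rewrite G; [move/B0->|move/A1->|move/Q01]; lra.
Qed.

Lemma parallelepiped_box Q : is_parallelepiped Q ->
  exists p V, row_free V /\ Q = box p V.
Proof.
move=> [p [V [V_free ->]]]; exists p, V; split=> //.
apply/seteqP; split=> [_ [c /= c01 <-] k|x xB]; first by rewrite coordK.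
have [c xE] := coord_surj p V_free x; exists c => //= j.
by have := xB j; rewrite xE coordK.
Qed.

Lemma box_slab p V k (t : bool) A B : row_free V ->
  (forall x, A x -> box_coord p V k x = t%:R) ->
  (forall x, B x -> box_coord p V k x = (~~ t)%:R) -> slab (box p V) A B.
Proof.
move=> V_free; wlog -> : t A B / t = true => [W A1 B1|A1 B0].
  case: t A1 B1 => [|A1 B1]; first exact: W.
  by apply: slab_sym; apply: (W true).
exists (box_dual V k), (- dot p (box_dual V k)); split=> x.
- by rewrite -coordE; exact: A1.
- by rewrite -coordE; exact: B0.
- by rewrite -coordE => /(_ k).
Qed.

(** Distinct parallel edges differ in a coordinate that is constant on each of them, and this
    coordinate or its complement to 1 separates them. *)
Lemma parallel_edges_slab Q A B : is_parallelepiped Q -> is_edge Q A ->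
  is_edge Q B -> parallel A B -> A <> B -> slab Q A B.
Proof.
move=> /parallelepiped_box[p [V [V_free ->]]].
move=> /(edge_box_edge V_free)[k [e ->]] /(edge_box_edge V_free)[l [e' ->]].
move=> /(parallel_box_edge _ V_free) <- neq.
have [[m [mk ee']]|nex] := pselect (exists m, m != k /\ e m != e' m).
  apply: (box_slab (k := m) (t := e m)) => // x [_ /(_ _ mk) ->] //.
  by move: ee'; case: (e m); case: (e' m).
case: neq; apply/seteqP; split=> x [x01 xe]; split=> // q qk; rewrite xe //;
  congr (_%:R); congr nat_of_bool; apply/eqP; apply: contra_notT nex => H;
  by exists q; split=> //; first [exact: H|rewrite eq_sym].
Qed.

Lemma edge_sub Q A : is_edge Q A -> A `<=` Q.
Proof. by move=> [[H _ ->] _] x []. Qed.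

Lemma slab_antipodal m (e : 'I_m -> set E) Q : one_in_each s e ->
  (forall k, e k `<=` Q) -> (forall k l, k != l -> slab Q (e k) (e l)) ->
  antipodal s.
Proof.
move=> [f [/bij_inj f_inj sf]] eQ slabs; apply: separates_antipodal => // i j ij.
have fij : f i != f j by rewrite (inj_eq f_inj).
have [w [c [H1 H0 H01]]] := slabs _ _ fij.
exists w, c; split=> [x /sf/H1|x /sf/H0|k x /sf/eQ/H01] //.
Qed.

Lemma four_parallel_edges_antipodal :
  on_four_parallel_edges s -> antipodal s /\ n = 4%N.
Proof.
move=> [Q [e [Qp e_inj eE par one]]]; split; last exact: one_in_each_card one.
apply: (slab_antipodal one (Q := Q)) => [k|k l kl]; first exact: edge_sub.
apply: parallel_edges_slab => // /e_inj; exact/eqP.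
Qed.

Lemma opposite_faces_antipodal :
  on_parallel_edges_of_opposite_faces s -> antipodal s /\ n = 4%N.
Proof.
move=> [Q [F [G [e1 [e2 [e3 [e4]]]]]]] [Qp [[H HQ [FE FH]] [H' HQ' [GE GH']] FG nFG]].
move=> [E1 E2 e1F e2F n12] [E3 E4 e3G e4G n34] [p12 p34 _ one].
split; last exact: one_in_each_card one.
have HH' : parallel_supporting_planes Q H H'.
  split=> //; last by move=> HH'; apply: nFG; rewrite FE GE HH'.
  move: FG => [v vE]; exists v; rewrite FH GH' in vE.
  by rewrite -FH -GH' !(aff_hull_id (@aff_hull_affine _ _)) FH GH'.
(* Edges in different facets are separated by the planes of the facets, edges in the same facet by
   [parallel_edges_slab]. *)
have across A B : A `<=` F -> B `<=` G -> slab Q A B.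
  move=> AF BG; have /parallel_supportingP[w [c [HE HE' Q01 _ _]]] := HH'.
  exists w, c; split=> // x; first by move/AF; rewrite FE HE => -[].
  by move/BG; rewrite GE HE' => -[].
have s12 : slab Q e1 e2 by apply: parallel_edges_slab.
have s34 : slab Q e3 e4 by apply: parallel_edges_slab.
have s13 := across _ _ e1F e3G; have s14 := across _ _ e1F e4G.
have s23 := across _ _ e2F e3G; have s24 := across _ _ e2F e4G.
apply: (slab_antipodal one (Q := Q)).
  by move=> [[|[|[|[|//]]]] ?]; rewrite (tnth_nth set0) /=; exact: edge_sub.
move=> [[|[|[|[|//]]]] ?] [[|[|[|[|//]]]] ?] //= _; rewrite !(tnth_nth set0) //=;
  exact: slab_sym.
Qed.

Lemma skew_edges_strictly_antipodal : (forall i, convex_set (s i)) ->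
  inside_three_skew_edges s -> strictly_antipodal s /\ n = 3%N.
Proof.
move=> s_conv [Q [e [Qp eE skew_e one]]]; split; last exact: one_in_each_card one.
have [p [V [V_free QE]]] := parallelepiped_box Qp.
have /choice[dir /choice[eps eE']] k : exists l f, e k = box_edge p V l f.
  by have := eE k; rewrite QE => /(edge_box_edge V_free).
have [f [/bij_inj f_inj sf]] := one.
have sE i x : s i x -> box_edge p V (dir (f i)) (eps (f i)) x /\
    0 < box_coord p V (dir (f i)) x < 1.
  by move/sf; rewrite eE' relint_box_edge.
have skew_dir i j : i != j -> dir (f i) != dir (f j) /\
    exists m, [/\ m != dir (f i), m != dir (f j) & eps (f i) m != eps (f j) m].
  move=> ij; have fij : f i != f j by rewrite (inj_eq f_inj).
  by have := skew_e _ _ fij; rewrite !eE' => /(skew_box_edge _ V_free).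
apply: strictly_separates_antipodal => // i j ij.
have [dij [m [mi mj eij]]] := skew_dir i j ij.
have : exists w c, [/\ forall x, s i x -> dot x w + c = 1,
    forall x, s j x -> dot x w + c = 0,
    forall x, 0 <= box_coord p V m x <= 1 -> 0 <= dot x w + c <= 1
    & forall x, 0 < box_coord p V m x < 1 -> 0 < dot x w + c < 1].
  have siE x : s i x -> box_coord p V m x = (eps (f i) m)%:R.
    by move=> /sE[[_ H] _]; rewrite H.
  have sjE x : s j x -> box_coord p V m x = (eps (f j) m)%:R.
    by move=> /sE[[_ H] _]; rewrite H.
  have G x : dot x (- box_dual V m) + (1 + dot p (box_dual V m)) =
    1 - box_coord p V m x.
    by rewrite coordE dotNr; ring.
  move: eij siE sjE; case: (eps _ m); case: (eps _ m) => // _ siE sjE.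
    exists (box_dual V m), (- dot p (box_dual V m)).
    by split=> x; rewrite -coordE; [exact: siE|exact: sjE| |].
  exists (- box_dual V m), (1 + dot p (box_dual V m)).
  by split=> x; rewrite G; [move/siE->|move/sjE->| |]; rewrite /=; lra.
move=> [w [c [H1 H0 H01 H01s]]]; exists w, c; split.
  split=> // k x /sE[xe _]; apply: H01; exact: (box_edge_box xe).
(* The three directions are distinct, so the third segment runs in direction m, and lying in a
   relative interior it has m-th coordinate strictly between 0 and 1. *)
move=> k x ki kj /sE[_]; suff -> : dir (f k) = m by exact: H01s.
have [dki _] := skew_dir _ _ ki; have [dkj _] := skew_dir _ _ kj.
clear eij H01 H01s; move: (dir (f i)) (dir (f j)) (dir (f k)) m dij mi mj dki dkj.
by do 4 apply: ord3P.
Qed.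

Lemma prism_strictly_antipodal : (forall i, convex_set (s i)) ->
  on_lateral_edges_of_triangular_prism s -> strictly_antipodal s /\ n = 3%N.
Proof.
move=> s_conv [t [u [span one]]]; split; last exact: one_in_each_card one.
pose V := rows3 (t 1 - t 0) (t 2 - t 0) u.
have V_free : row_free V.
  (* A dependency yields a vector [w] normal to the triangle and to [u], so the prism would lie in a
     plane. *)
  apply: contraT => nfree;
    have : ~~ row_free V^T by rewrite row_free_unit unitmx_tr -row_free_unit.
  move=> /dependent_row[w w0 wV].
  have Vw q : dot (row q V) w = 0.
    transitivity ((w *m V^T) 0 q); last by rewrite wV mxE.
    by rewrite dotC dotE [RHS]mxE; apply: eq_bigr => r _; rewrite !mxE.
  suff : aff_hull (conv_hull (range t `|` range (fun k => t k + u))) `<=`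
      [set x | dot x w + - dot (t 0) w = 0].
    rewrite span => /(_ (t 0 + w) I) /=; rewrite dotDl => H.
    by move: w0; rewrite -dotxx_eq0 (_ : dot w w = 0) ?eqxx //; lra.
  have V0 := Vw 0; have V1 := Vw 1; have V2 := Vw 2.
  rewrite aff_conv_hull; apply: aff_hull_sub; first exact: affine_level.
  have T q : dot (t q) w = dot (t 0) w.
    move: V0 V1; rewrite !row_rows3 !dotBl; move: q; apply: ord3P => //; lra.
  rewrite row_rows3 in V2.
  by move=> _ [[q _ <-]|[q _ <-]] /=; rewrite ?dotDl T ?V2; lra.
(* An affine function constant along [u] may take arbitrary values on the three lateral edges; 1, 0
   and 1/2 are the values needed. *)
have interp (lam : 'I_3 -> R) : exists w c, forall q r,
    dot (t q + r *: u) w + c = lam q.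
  pose w := (lam 1 - lam 0) *: box_dual V 0 + (lam 2 - lam 0) *: box_dual V 1.
  pose c := lam 0 - dot (t 0) w.
  have coordE0 q r al be : t q - t 0 = al *: (t 1 - t 0) + be *: (t 2 - t 0) ->
      box_coord (t 0) V 0 (t q + r *: u) =
        al /\ box_coord (t 0) V 1 (t q + r *: u) = be.
    move=> tqE; have -> : t q + r *: u = t 0 + (\row_(m < 3) nth 0 [:: al; be;
      r] m) *m V.
      by rewrite mul_rows3 !mxE /= -tqE addrA [t 0 + _]addrC subrK.
    by rewrite !coordK // !mxE.
  have H q r : dot (t q + r *: u) w + c = lam 0 +
     (lam 1 - lam 0) * box_coord (t 0) V 0 (t q + r *: u) +
     (lam 2 - lam 0) * box_coord (t 0) V 1 (t q + r *: u).
    by rewrite /c /w !coordE !dotDr !dotZr; ring.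
  exists w, c => q r; rewrite H; move: q {H}; apply: ord3P.
  - have [|-> ->] := coordE0 0 r 0 0; first by rewrite subrr !scale0r addr0.
    by ring.
  - have [|-> ->] := coordE0 1 r 1 0; first by rewrite scale1r scale0r addr0.
    by ring.
  - have [|-> ->] := coordE0 2 r 0 1; first by rewrite scale1r scale0r add0r.
    by ring.
have [f [/bij_inj f_inj sf]] := one.
have sE i x : s i x -> exists r, x = t (f i) + r *: u.
  by move/sf; rewrite conv_hull2 [t _ + u]addrC addrK => -[r _ <-]; exists r.
apply: strictly_separates_antipodal => // i j ij.
pose lam q : R := if q == f i then 1 else if q == f j then 0 else 2^-1.
have [w [c wc]] := interp lam; exists w, c; split.
  split=> [x /sE[r ->]|x /sE[r ->]|k x /sE[r ->]]; rewrite wc /lam.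
  - by rewrite eqxx.
  - by rewrite eqxx (inj_eq f_inj) eq_sym (negPf ij).
  - by case: ifP => _; [lra|case: ifP => _; lra].
move=> k x ki kj /sE[r ->].
by rewrite wc /lam !(inj_eq f_inj) (negPf ki) (negPf kj); lra.
Qed.

End Converse.

Theorem theorem4p1 (R : realType) (n : nat) (s : 'I_n -> set 'rV[R]_3)
    (s_inj : injective s)
    (s_seg : forall i, is_segment (s i))
    (s_span : aff_hull (\bigcup_i s i) = setT) :
  [/\ antipodal s -> (n <= 4)%N,
      strictly_antipodal s -> (n <= 3)%N,
      antipodal s /\ n = 4%N <->
        on_four_parallel_edges s \/ on_parallel_edges_of_opposite_faces s
    & strictly_antipodal s /\ n = 3%N <->
        on_lateral_edges_of_triangular_prism s \/ inside_three_skew_edges s].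
Proof.
have /choice[a /choice[b ab]] := s_seg.
have ab_neq i : b i - a i != 0 by rewrite subr_eq0 eq_sym; have [] := ab i.
have sE i : s i = conv_hull [set a i; b i] by have [] := ab i.
have s_neq0 i : s i !=set0 by exists (a i); exact: s_a sE i.
have s_conv i : convex_set (s i) by rewrite sE; exact: conv_hull_convex.
(* Separating functions are chosen for all pairs at once, with the default (0, 0) on the
   diagonal. *)
have choose P : (forall i j : 'I_n, i != j -> exists w c, P i j w c) ->
    exists (w : 'I_n -> 'I_n -> 'rV[R]_3) (c : 'I_n -> 'I_n -> R),
      forall i j, i != j -> P i j (w i j) (c i j).
  move=> H; have /choice[f fP] (ij : 'I_n * 'I_n) : exists wc : 'rV[R]_3 * R,
      ij.1 != ij.2 -> P ij.1 ij.2 wc.1 wc.2.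
    case: (eqVneq ij.1 ij.2) => [->|/H[w [c Pwc]]]; first by exists (0, 0);
      rewrite ?eqxx.
    by exists (w, c).
  by exists (fun i j => (f (i, j)).1), (fun i j => (f (i, j)).2) => i j;
    exact: (fP (i, j)).
have ord_embedding m (mn : (m <= n)%N) : exists g : 'I_m -> 'I_n, injective g.
  by exists (widen_ord mn) => i j /(congr1 val)/= /val_inj.
split.
- move=> /antipodal_separates/choose[w [c sep]]; rewrite leqNgt; apply/negP.
  (* [4 < n] unfolds to [5 <= n], so [g] provides five distinct indices. *)
  move=> /ord_embedding[g g_inj].
  have neq i j : i != j -> g i != g j by rewrite (inj_eq g_inj).
  by apply: (@antipodal_le4 _ _ a b w c ab_neq (F_top sE sep) (F_bot sE sep) (F_01 sE sep)
    (g 0) (g 1) (g 2) (g 3) (g 4)); apply: neq.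
- move=> /(strictly_antipodal_separates)/choose[w [c sep]]; rewrite leqNgt; apply/negP.
  move=> /ord_embedding[g g_inj].
  have neq i j : (g i == g j) = (i == j) by rewrite (inj_eq g_inj).
  have sep' i j : i != j -> separates s i j (w i j) (c i j) by move=> /sep[].
  apply: (strictly_antipodal_le3 sE ab_neq sep' _ (i := g 0) (j := g 1)
     (k := g 2) (l := g 3)).
    by move=> i j k x ij; have [_] := sep i j ij; apply.
  by rewrite /= !inE !neq.
- split=> [[/antipodal_separates/choose[w [c sep]] n4]|[|]].
  + have [g g_inj] := ord_embedding 4%N (eq_leq (esym n4)).
    have neq i j : (g i == g j) = (i == j) by rewrite (inj_eq g_inj).
    apply: (antipodal4_configurations sE ab_neq sep (i := g 0) (j := g 1)
     (k := g 2) (l := g 3)) => //.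
    by rewrite /= !inE !neq.
  + exact: four_parallel_edges_antipodal.
  + exact: opposite_faces_antipodal.
- split=> [[/strictly_antipodal_separates/choose[w [c sep]] n3]|[|]].
  + have [g g_inj] := ord_embedding 3%N (eq_leq (esym n3)).
    have neq i j : (g i == g j) = (i == j) by rewrite (inj_eq g_inj).
    have sep' i j : i != j -> separates s i j (w i j) (c i j) by move=> /sep[].
    apply: (strictly_antipodal3_configurations sE ab_neq sep' _ (i := g 0)
     (j := g 1) (k := g 2)) => //.
      by move=> i j k x ij; have [_] := sep i j ij; apply.
    by rewrite /= !inE !neq.
  + exact: prism_strictly_antipodal.
  + exact: skew_edges_strictly_antipodal.
Qed.
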